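(* There exists a unique multiplication $*$ on the free $R_1$-module ${}^{BL}\mathcal H_{R_1}$ which makes it an associative unitary $R_1$-algebra with unity $H_1$ and satisfies the following conditions: (1) for all $\lambda\in Y$, $w\in W^v$: $Z^\lambda*H_w=Z^\lambda H_w$; (2) for all $i\in I$, $w\in W^v$: $H_i*H_w=H_{r_iw}$ if $\ell(r_iw)>\ell(w)$, and $H_i*H_w=(\sigma_i-\sigma_i^{-1})H_w+H_{r_iw}$ if $\ell(r_iw)<\ell(w)$; (3) for all $\lambda,\mu\in Y$: $Z^\lambda*Z^\mu=Z^{\lambda+\mu}$; (4) for all $\lambda\in Y$, $i\in I$: $H_i*Z^\lambda-Z^{r_i(\lambda)}*H_i=b(\sigma_i,\sigma_i';Z^{-\alpha_i^\vee})(Z^\lambda-Z^{r_i(\lambda)})$, where $b(t,u;z)=\dfrac{(t-t^{-1})+(u-u^{-1})z}{1-z^2}$.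
   Context: $V$ is a finite-dimensional real vector space, $I$ a finite set; $(\alpha_i)_{i\in I}$ in $V^*$ and $(\alpha_i^\vee)_{i\in I}$ in $V$ are linearly independent families such that $(\alpha_j(\alpha_i^\vee))_{i,j\in I}$ is a generalized Cartan matrix. $r_i(v)=v-\alpha_i(v)\alpha_i^\vee$; $W^v=\langle r_i\mid i\in I\rangle\subset GL(V)$ is a Coxeter group with generators $r_i$ and length $\ell$; $\Phi=\{w(\alpha_i)\mid w\in W^v,i\in I\}$. $Y\subset V$ is a discrete subgroup with $\bigoplus_i\mathbb Z\alpha_i^\vee\subset Y\subset\{v\in V\mid\alpha(v)\in\mathbb Z\ \forall\alpha\in\Phi\}$, stable under $W^v$. $R_1=\mathbb Z[(\sigma_i^{\pm1},{\sigma_i'}^{\pm1})_{i\in I}]$ is the Laurent polynomial ring in indeterminates $\sigma_i,\sigma_i'$ subject only to the identifications: $\sigma_i=\sigma_i'$ if $\alpha_i(Y)=\mathbb Z$; $\sigma_i=\sigma_j=\sigma_i'=\sigma_j'$ if $\alpha_i(\alpha_j^\vee)=\alpha_j(\alpha_i^\vee)=-1$. ${}^{BL}\mathcal H_{R_1}$ is the free $R_1$-module with basis denoted $(Z^\lambda H_w)_{\lambda\in Y,w\in W^v}$. One writes $H_i=Z^0H_{r_i}$, $H_w=Z^0H_w$, $Z^\lambda=Z^\lambda H_1$ (so $H_1=Z^0$). By (3) the $Z^\lambda$ span a copy of the group algebra $R_1[Y]$; the right-hand side of (4) is the element of $R_1[Y]$ obtained by exact division, namely $\sum_{0\le k\le\alpha_i(\lambda)-1,\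 k\ even}(\sigma_i-\sigma_i^{-1})Z^{\lambda-k\alpha_i^\vee}+\sum_{0\le k\le\alpha_i(\lambda)-1,\ k\ odd}(\sigma_i'-{\sigma_i'}^{-1})Z^{\lambda-k\alpha_i^\vee}$ if $\alpha_i(\lambda)\ge0$, and $-\sum_{2\le k\le-\alpha_i(\lambda),\ k\ even}(\sigma_i-\sigma_i^{-1})Z^{\lambda+k\alpha_i^\vee}-\sum_{1\le k\le-\alpha_i(\lambda),\ k\ odd}(\sigma_i'-{\sigma_i'}^{-1})Z^{\lambda+k\alpha_i^\vee}$ if $\alpha_i(\lambda)<0$ (recall $\sigma_i=\sigma_i'$ when $\alpha_i(\lambda)$ is odd). *)

(* Defs.v *)
From HB Require Import structures.
From mathcomp Require Import all_boot all_order all_algebra fraction.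
From mathcomp Require Import freeg mpoly zify.
From mathcomp Require Import boolp classical_sets reals topology.

Set Implicit Arguments.
Unset Strict Implicit.
Unset Printing Implicit Defensive.

Import Order.TTheory GRing.Theory Num.Theory.
Import numFieldTopology.Exports.

Local Open Scope ring_scope.

(* Z[t^{+-1} | t in T] is the subring of Frac Z[t | t in T] consisting of the
   fractions whose denominator is a monomial. *)
Section Laurent.
Variable T : finType.

Local Notation P := {mpoly int[#|T|]}.

Definition laurent_pred : {pred {fraction P}} :=
  fun f => `[< exists (p : P) (m : 'X_{1..#|T|}),
                 f = tofrac p / tofrac 'X_[m] >].

Fact mpolyX_neq0 (m : 'X_{1..#|T|}) : 'X_[m] != 0 :> P.
Proof.
by apply/eqP => /(congr1 (mcoeff m)); rewrite mcoeffX eqxx mcoeff0 => /eqP.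
Qed.

Fact tofracX_neq0 (m : 'X_{1..#|T|}) : tofrac ('X_[m] : P) != 0.
Proof. by rewrite tofrac_eq0 mpolyX_neq0. Qed.

Fact laurent_subring : subring_closed laurent_pred.
Proof.
split=> [|f g|f g].
- by apply/asboolP; exists 1, 0%MM; rewrite mpolyX0 rmorph1 divr1.
- move=> /asboolP[p [m ->]] /asboolP[q [n ->]]; apply/asboolP.
  exists (p * 'X_[n] - q * 'X_[m]), (m + n)%MM.
  rewrite mpolyXD rmorphB !rmorphM /= -[X in _ + X = _]mulNr.
  by rewrite addf_div ?tofracX_neq0 // mulNr.
- move=> /asboolP[p [m ->]] /asboolP[q [n ->]]; apply/asboolP.
  by exists (p * q), (m + n)%MM; rewrite mpolyXD !rmorphM /= mulf_div.
Qed.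

HB.instance Definition _ :=
  GRing.isSubringClosed.Build {fraction P} laurent_pred laurent_subring.

Record laurent := Laurent { laurent_val : {fraction P};
                            _ : laurent_val \in laurent_pred }.

HB.instance Definition _ := [isSub for laurent_val].
HB.instance Definition _ := [Choice of laurent by <:].
HB.instance Definition _ := [SubChoice_isSubComNzRing of laurent by <:].

Definition laurent_unit : {pred laurent} :=
  fun f => (val f != 0) && ((val f)^-1 \in laurent_pred).

Definition laurent_inv (f : laurent) : laurent :=
  if laurent_unit f then insubd f (val f)^-1 else f.

Fact laurent_mulVf : {in laurent_unit, left_inverse 1 laurent_inv *%R}.
Proof.
move=> f uf; apply: val_inj; have /andP[f0 fV] := uf.
by rewrite rmorphM rmorph1 /= /laurent_inv ifT // insubdK // mulVf.
Qed.

Fact laurent_unitPl (f g : laurent) : g * f = 1 -> laurent_unit f.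
Proof.
move=> /(congr1 val); rewrite rmorphM rmorph1 /= => gf1.
have f0 : val f != 0.
  by apply/eqP => f0; move/eqP: gf1; rewrite /= f0 mulr0 eq_sym oner_eq0.
rewrite /laurent_unit f0 /=.
have -> : (laurent_val f)^-1 = laurent_val g.
  by rewrite -[LHS]mul1r -gf1 mulfK.
exact: valP g.
Qed.

Fact laurent_inv_out : {in [predC laurent_unit], laurent_inv =1 id}.
Proof. by move=> f /negPf; rewrite /laurent_inv -topredE /= => ->. Qed.

HB.instance Definition _ := GRing.ComNzRing_hasMulInverse.Build laurent
  laurent_mulVf laurent_unitPl laurent_inv_out.

Fact laurent_var_subproof (t : T) :
  tofrac ('X_(enum_rank t) : P) \in laurent_pred.
Proof.
by apply/asboolP; exists 'X_(enum_rank t), 0%MM; rewrite mpolyX0 rmorph1 divr1.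
Qed.

Definition laurent_var (t : T) : laurent := Laurent (laurent_var_subproof t).

Fact laurent_var_unit (t : T) : laurent_var t \is a GRing.unit.
Proof.
rewrite unfold_in /= /laurent_unit /= tofracX_neq0 /=.
by apply/asboolP; exists 1, U_(enum_rank t)%MM; rewrite rmorph1 mul1r.
Qed.

End Laurent.

Section RootData.
Variables (R : realType) (V : vectType R) (I : finType).

Definition generalized_cartan (A : I -> I -> R) : Prop :=
  [/\ forall i, A i i = 2,
      forall i j, i != j -> A i j \is a Num.int /\ A i j <= 0
    & forall i j, A i j = 0 -> A j i = 0].

Section Weyl.
Variables (a : I -> 'Hom(V, R^o)) (c : I -> V).

Definition refl (i : I) : 'End(V) := linfun (fun v : V => v - a i v *: c i).

Inductive in_weyl : 'End(V) -> Prop :=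
| weyl_id : in_weyl \1%VF
| weyl_refl i : in_weyl (refl i)
| weyl_comp u v : in_weyl u -> in_weyl v -> in_weyl (u \o v)%VF
| weyl_inv u : in_weyl u -> in_weyl (u^-1)%VF.

(* w acts on V^* by (w f)(v) = f (w^-1 v). *)
Definition real_root (f : 'Hom(V, R^o)) : Prop :=
  exists (w : 'End(V)) (i : I), in_weyl w /\ f = (a i \o w^-1)%VF.

End Weyl.

(* The topology of V is the one transported from R^(dim V) by the coordinates
   in a basis; it does not depend on the basis. *)
Definition coordinates (v : V) : 'rV[R]_(\dim {:V}) :=
  \row_k coord (vbasis {:V}) k v.

Definition discrete_subset (S : {pred V}) : Prop :=
  let CS := [set coordinates v | v in [set v | v \in S]]%classic in
  isolated CS = CS.

Record root_datum := RootDatum {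
  simple_root : I -> 'Hom(V, R^o);
  simple_coroot : I -> V;
  lattice : {pred V};
  simple_root_free : free (codom simple_root);
  simple_coroot_free : free (codom simple_coroot);
  cartanP :
    generalized_cartan (fun i j => simple_root j (simple_coroot i));
  lattice_zmod : zmod_closed lattice;
  lattice_discrete : discrete_subset lattice;
  coroot_lattice : forall n : I -> int,
    \sum_i simple_coroot i *~ n i \in lattice;
  lattice_integral : forall y f, y \in lattice ->
    real_root simple_root simple_coroot f -> f y \is a Num.int;
  lattice_weyl : forall w y, in_weyl simple_root simple_coroot w ->
    y \in lattice -> w y \in lattice
}.

End RootData.

Section Objects.
Variables (R : realType) (V : vectType R) (I : finType) (D : root_datum V I).

Local Notation a := (simple_root D).
Local Notation ac := (simple_coroot D).
Local Notation r := (refl a ac).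

Lemma reflE i v : r i v = v - a i v *: ac i.
Proof.
pose f (v : V) := v - a i v *: ac i.
have fL : linear f.
  move=> k x y; rewrite /f linearP /= scalerDl opprD scalerBr scalerA addrACA.
  by [].
pose fl := GRing.isLinear.Build R V V _ f fL.
pose F : {linear V -> V} := HB.pack f fl.
by rewrite /refl -[RHS]/(F v) -[fun _ => _]/(F : V -> V) lfunE.
Qed.

Lemma refl_invol i : (r i \o r i)%VF = \1%VF.
Proof.
apply/lfunP => v; rewrite comp_lfunE id_lfunE !reflE.
have a2 : a i (ac i) = 2 by case: (cartanP D).
have -> : a i (v - a i v *: ac i) = - a i v.
  by rewrite linearB linearZ_LR /= a2 [X in _ - X]mulr_natr mulr2n opprD
             addrA subrr sub0r.
by rewrite scaleNr opprK subrK.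
Qed.

Definition weyl_type := {w : 'End(V) | `[< in_weyl a ac w >]}.
HB.instance Definition _ := Choice.on weyl_type.

Definition weyl1 : weyl_type := exist _ \1%VF (asboolT (weyl_id a ac)).

Definition weyl_s (i : I) : weyl_type :=
  exist _ (r i) (asboolT (weyl_refl a ac i)).

Definition weyl_mul (u v : weyl_type) : weyl_type :=
  exist _ (val u \o val v)%VF
    (asboolT (weyl_comp (asboolW (valP u)) (asboolW (valP v)))).

Definition weyl_word (s : seq I) : 'End(V) :=
  foldr (fun i w => (r i \o w)%VF) \1%VF s.

Definition has_word (w : weyl_type) (n : nat) : bool :=
  [exists s : n.-tuple I, weyl_word s == val w].

Lemma weyl_word_cat s t :
  weyl_word (s ++ t) = (weyl_word s \o weyl_word t)%VF.
Proof.
elim: s => [|i s IHs] /=; first by rewrite comp_lfun1l.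
by rewrite IHs comp_lfunA.
Qed.

Lemma weyl_word_rev s : (weyl_word s \o weyl_word (rev s))%VF = \1%VF.
Proof.
elim: s => [|i s IHs] /=; first by rewrite comp_lfun1l.
rewrite rev_cons -cats1 weyl_word_cat /= comp_lfun1r -comp_lfunA.
by rewrite [X in (_ \o X)%VF]comp_lfunA IHs comp_lfun1l refl_invol.
Qed.

Lemma in_weyl_word w : in_weyl a ac w -> exists s, weyl_word s = w.
Proof.
elim=> [|i|u v _ [s <-] _ [t <-]|u _ [s <-]].
- by exists [::].
- by exists [:: i]; rewrite /= comp_lfun1r.
- by exists (s ++ t); rewrite weyl_word_cat.
- exists (rev s).
  have K : lker (weyl_word s) == 0%VS.
    apply/lker0P => x y exy.
    have E := weyl_word_rev (rev s); rewrite revK in E.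
    by rewrite -[x]id_lfunE -[y]id_lfunE -E !comp_lfunE exy.
  rewrite -[LHS]comp_lfun1l -(lker0_compVf K) -comp_lfunA weyl_word_rev.
  by rewrite comp_lfun1r.
Qed.

Lemma weyl_has_word w : exists n, has_word w n.
Proof.
have [s sw] := in_weyl_word (asboolW (valP w)).
by exists (size s); apply/existsP; exists (in_tuple s); apply/eqP.
Qed.

Definition weyl_length (w : weyl_type) : nat := ex_minn (weyl_has_word w).

HB.instance Definition _ :=
  GRing.isZmodClosed.Build V (lattice D) (lattice_zmod D).

Definition lattice_type := {y : V | y \in lattice D}.
HB.instance Definition _ := SubChoice.on lattice_type.
HB.instance Definition _ := [SubChoice_isSubZmodule of lattice_type by <:].

Definition weyl_act (w : weyl_type) (y : lattice_type) : lattice_type :=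
  exist _ (val w (val y)) (lattice_weyl (asboolW (valP w)) (valP y)).

Fact coroot_in_lattice i : ac i \in lattice D.
Proof.
have := coroot_lattice D (fun j => (j == i)%:R).
rewrite (bigD1 i) //= eqxx mulr1z big1 ?addr0 // => j /negPf ->.
by rewrite mulr0z.
Qed.

Definition coroot (i : I) : lattice_type := exist _ (ac i) (coroot_in_lattice i).

(* alpha_i(y) is an integer for y in the lattice, so floor is just the cast. *)
Definition pairing (i : I) (y : lattice_type) : int := Num.floor (a i (val y)).

(* The indeterminates are indexed by I * bool: (i, false) stands for sigma_i
   and (i, true) for sigma'_i.  Those of R_1 are the classes for the
   equivalence relation generated by [identified]. *)
Definition identified : rel (I * bool) := fun x y =>
  let: ((i, _), (j, _)) := (x, y) in
  ((i == j) &&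
   `[< ([set a i v | v in [set v | v \in lattice D]] =
        [set x | x \is a Num.int])%classic >])
  || ((a i (ac j) == -1) && (a j (ac i) == -1)).

Definition param_class (x : I * bool) : {set I * bool} :=
  [set y | connect identified x y].

Definition param := {A : {set I * bool} | A \in codom param_class}.
HB.instance Definition _ := Finite.on param.

Definition param_of (x : I * bool) : param :=
  exist _ (param_class x) (codom_f param_class x).

Definition R1 := laurent param.
HB.instance Definition _ := GRing.ComUnitRing.on R1.

Definition sigma (i : I) : R1 := laurent_var (param_of (i, false)).
Definition sigma' (i : I) : R1 := laurent_var (param_of (i, true)).

Definition hecke := {freeg (lattice_type * weyl_type) / R1}.
HB.instance Definition _ := GRing.Lmodule.on hecke.

Definition ZH (y : lattice_type) (w : weyl_type) : hecke := << (y, w) >>.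
Definition ZL (y : lattice_type) : hecke := ZH y weyl1.
Definition HW (w : weyl_type) : hecke := ZH 0 w.
Definition HS (i : I) : hecke := HW (weyl_s i).

(* b(sigma_i, sigma'_i; Z^{-alpha_i^vee}) (Z^y - Z^{r_i y}), where
   b(t, u; z) = ((t - t^-1) + (u - u^-1) z) / (1 - z^2) and the division by
   1 - Z^{-2 alpha_i^vee} is carried out in R_1[Y]: see [bernsteinE]. *)
Definition bernstein (i : I) (y : lattice_type) : hecke :=
  let s := sigma i - (sigma i)^-1 in
  let s' := sigma' i - (sigma' i)^-1 in
  let n := `|pairing i y|%N in
  if 0 <= pairing i y then
    \sum_(0 <= k < n | ~~ odd k) s *: ZL (y - coroot i *+ k) +
    \sum_(0 <= k < n | odd k) s' *: ZL (y - coroot i *+ k)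
  else
    - (\sum_(2 <= k < n.+1 | ~~ odd k) s *: ZL (y + coroot i *+ k))
    - \sum_(1 <= k < n.+1 | odd k) s' *: ZL (y + coroot i *+ k).

Definition unital_algebra (A : lmodType R1) (mul : A -> A -> A) (one : A) :=
  [/\ forall x, linear (mul x), forall y, linear (mul^~ y),
      associative mul, left_id one mul & right_id one mul].

End Objects.

Section Theory.
Variables (R : realType) (V : vectType R) (I : finType) (D : root_datum V I).

Local Notation a := (simple_root D).
Local Notation ac := (simple_coroot D).

Lemma pairingE i (y : lattice_type D) : a i (val y) = (pairing i y)%:~R.
Proof.
suff : a i (val y) \is a Num.int by rewrite intrEfloor => /eqP <-.
apply: (lattice_integral (valP y)); exists \1%VF, i; split.
  exact: weyl_id.
have -> : (\1^-1 = \1 :> 'End(V))%VF.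
  rewrite -[LHS]comp_lfun1l lker0_compfV //.
  by apply/lker0P => u v; rewrite !id_lfunE.
by rewrite comp_lfun1r.
Qed.

Lemma weyl_act_s i (y : lattice_type D) :
  weyl_act (weyl_s D i) y = y - coroot D i *~ pairing i y.
Proof.
apply: val_inj; rewrite [RHS]raddfB [X in _ - X]raddfMz /= reflE.
by rewrite (pairingE i y) scaler_int.
Qed.

Lemma identified_sym : ssrbool.symmetric (identified D).
Proof.
move=> [i b] [j c]; rewrite /identified [X in _ || X]andbC eq_sym.
by have [->|] := eqVneq.
Qed.

Lemma param_ofE x y : (param_of D x == param_of D y) = connect (identified D) x y.
Proof.
have csym := sym_connect_sym identified_sym.
apply/eqP/idP => [/(congr1 val)/= exy|cxy].
  have : y \in param_class D y by rewrite inE connect0.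
  by rewrite -exy inE.
apply: val_inj; apply/setP => z; rewrite /= !inE.
exact: same_connect cxy z.
Qed.

Lemma sigma_sigma' i :
  ([set a i v | v in [set v | v \in lattice D]] =
     [set x | x \is a Num.int])%classic -> sigma D i = sigma' D i.
Proof.
move=> aY; congr laurent_var; apply/eqP; rewrite param_ofE connect1 //.
by rewrite /identified eqxx asboolT.
Qed.

Lemma sigma_adjacent i j : a i (ac j) = -1 -> a j (ac i) = -1 ->
  [/\ sigma D i = sigma D j, sigma D i = sigma' D i & sigma' D i = sigma' D j].
Proof.
move=> aij aji; have cij b c : connect (identified D) (i, b) (j, c).
  by rewrite connect1 // /identified aij aji !eqxx orbT.
have csym := sym_connect_sym identified_sym.
split; congr laurent_var; apply/eqP; rewrite param_ofE //.
by rewrite (connect_trans (cij _ true)) // csym.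
Qed.

(* Multiplication by Z^mu on R_1[Y]. *)
Definition shift (mu : lattice_type D) : hecke D -> hecke D :=
  fglift (fun x => ZH (x.1 + mu) x.2).

Fact shift_additive mu : additive (shift mu).
Proof. exact: lift_is_additive. Qed.

HB.instance Definition _ mu :=
  GRing.isZmodMorphism.Build (hecke D) (hecke D) (shift mu) (shift_additive mu).

Lemma shiftZ mu (t : R1 D) y : shift mu (t *: ZL y) = t *: ZL (y + mu).
Proof.
have -> : t *: ZL y = << t *g (y, weyl1 D) >>.
  by apply/eqP/freeg_eqP => x; rewrite coeffZ !coeffU mul1r.
by rewrite /shift liftU.
Qed.

Lemma pairing_odd i (y : lattice_type D) : odd `|pairing i y| -> sigma D i = sigma' D i.
Proof.
move=> odd_n; apply: sigma_sigma'; apply/seteqP; split => [_ [v vY <-]|x].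
  by have := pairingE i (exist _ v vY); rewrite /= => ->; rewrite /= intr_int.
move=> /intrP[m ->] /=.
have [q nq] : exists q : int, pairing i y = q *+ 2 + 1.
  by exists (pairing i y %/ 2)%Z; lia.
exists ((val y - ac i *~ q) *~ m).
  rewrite /= rpredMz // rpredB //; first exact: valP.
  by rewrite rpredMz // coroot_in_lattice.
have a2 : a i (ac i) = 2 by case: (cartanP D).
rewrite raddfMz raddfB raddfMz /= (pairingE i y) nq a2.
rewrite -mulrzl rmorphD rmorphMn /= -mulr_natl -[2 *~ q]mulrzr.
by rewrite addrC addKr mulr1.
Qed.

Lemma tele (G : nat -> hecke D) (c : nat -> R1 D) n :
  (forall k, c k.+2 = c k) ->
  \sum_(0 <= k < n) (c k *: G k - c k *: G k.+2) =
  c 0 *: G 0 + c 1 *: G 1 - c n *: G n - c n.+1 *: G n.+1.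
Proof.
move=> cE; elim: n => [|n IHn].
  by rewrite big_geq // [c 0 *: G 0 + _]addrC addrK subrr.
rewrite big_nat_recr //= IHn cE addrA; congr (_ - _).
by rewrite [LHS]addrAC subrK.
Qed.

Lemma par_sum (G : nat -> hecke D) (s s' : R1 D) m n :
  \sum_(m <= k < n | ~~ odd k) s *: G k + \sum_(m <= k < n | odd k) s' *: G k
  = \sum_(m <= k < n) (if odd k then s' else s) *: G k.
Proof.
rewrite [RHS](bigID odd) /= addrC; congr (_ + _); apply: eq_bigr => k.
  by move/negPf => ->.
by move=> ->.
Qed.

Lemma bernsteinE i (y : lattice_type D) :
  let s := sigma D i - (sigma D i)^-1 in
  let s' := sigma' D i - (sigma' D i)^-1 in
  let x := ZL y - ZL (weyl_act (weyl_s D i) y) in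
  bernstein i y - shift (- (coroot D i *+ 2)) (bernstein i y) =
  s *: x + s' *: shift (- coroot D i) x.
Proof.
move=> s s' x; pose p := coroot D i; pose c k := if odd k then s' else s.
have cE k : c k.+2 = c k by rewrite /c /= negbK.
have codd : odd `|pairing i y| -> s' = s.
  by move=> /pairing_odd e; rewrite /s /s' e.
have shZ mu z : shift mu (ZL z) = ZL (z + mu).
  by rewrite -[ZL z]scale1r shiftZ scale1r.
rewrite /x [shift _ (ZL y - _)]raddfB /= !shZ /bernstein weyl_act_s -/s -/s' -/p.
case: ifP => [|/negbT]; last rewrite -ltNge.
  case: (pairing i y) codd => // n /= codd _.
  rewrite par_sum raddf_sum -sumrB.
  transitivity (\sum_(0 <= k < n)
      (c k *: ZL (y - p *+ k) - c k *: ZL (y - p *+ k.+2))).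
    apply: eq_bigr => k _; rewrite /= shiftZ; congr (_ - _ *: ZL _).
    by rewrite -addrA -opprD -mulrnDr addn2.
  rewrite (tele (fun k => ZL (y - p *+ k))) // /c /= subr0 mulr1n -pmulrn.
  have -> : y - p *+ n - p = y - p *+ n.+1 by rewrite -addrA -opprD -mulrSr.
  rewrite !scalerBr [RHS]addrACA addrA.
  by case: (odd n) codd => [->|] //=; rewrite addrAC.
case: (pairing i y) codd => // m /= codd _; set n := m.+1.
pose G k := ZL (y + p *+ n - p *+ k).
have -> : - \sum_(2 <= k < n.+1 | ~~ odd k) s *: ZL (y + p *+ k) -
   \sum_(1 <= k < n.+1 | odd k) s' *: ZL (y + p *+ k) =
   - \sum_(0 <= k < n) c k *: G k.
  rewrite -opprD; congr (- _).
  have -> : \sum_(2 <= k < n.+1 | ~~ odd k) s *: ZL (y + p *+ k) =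
            \sum_(1 <= k < n.+1 | ~~ odd k) s *: ZL (y + p *+ k).
    by rewrite [RHS]big_ltn_cond.
  rewrite par_sum big_add1 /= big_nat_rev /= add0n.
  apply: eq_big_nat => k /andP[_ kn]; rewrite /G; congr (_ *: ZL _).
    rewrite -[~~ odd _]/(odd (n - k.+1).+1) subnSK // oddB; last exact: ltnW.
    move: codd; rewrite -[~~ odd m]/(odd n) /c.
    by case: (odd n); case: (odd k) => // ->.
  by rewrite subnSK // mulrnBr ?addrA // ltnW.
rewrite raddfN -opprD raddf_sum -sumrB.
transitivity (- \sum_(0 <= k < n) (c k *: G k - c k *: G k.+2)).
  congr (- _); apply: eq_bigr => k _; rewrite /= shiftZ; congr (_ - _ *: ZL _).
  by rewrite -addrA -opprD -mulrnDr addn2.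
rewrite tele // /G /c NegzE mulrNz opprK -pmulrn -/n /= subr0 mulr1n.
have -> : y + p *+ n - p *+ n = y by rewrite addrK.
have -> : y + p *+ n - p *+ n.+1 = y - p.
  by rewrite [p *+ n.+1]mulrSr opprD addrA addrK.
rewrite !scalerBr [RHS]addrACA -[in LHS]addrA -opprD opprB opprD.
by case: (odd m) codd => //= ->.
Qed.
End Theory.

(* Main.v *)
(* Let T_i be the operator on the module which must be left multiplication by H_i,
   that is, which is forced by (1), (2) and (4), and let Z^mu act by translation.
   Put q = sigma - sigma^-1 and q' = sigma' - sigma'^-1.  The intertwiner
   tau_i = (1 - Z^(-2 a_i)) T_i - (q_i + q'_i Z^(-a_i)), where a_i is the coroot,
   satisfies tau_i Z^mu = Z^(r_i mu) tau_i; it is the twist by r_i followed by an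
   element of the Hecke algebra of W over R_1[Y], which acts on the factor H_w
   only.  The braid relations of the tau_i thus follow from Yang-Baxter equations
   for the generators of that Hecke algebra in rank 2, and Matsumoto's theorem
   gives operators tau_w.  Since tau_i^2 lies in R_1[Y], every operator E generated
   by the T_i and the Z^mu is, up to a nonzerodivisor of R_1[Y], an R_1[Y]-linear
   combination of the tau_w.  These are triangular on H_1, so that E = 0 as soon
   as E kills H_1.  Let Z^y H_w act by Z^y T_i1 ... T_ik for a reduced word of w:
   this defines the product, and x * (y * _) - (x * y) * _ kills H_1, which is
   associativity.  The braid relations of the T_i are never needed. *)

Require Import Defs.
From HB Require Import structures.
From mathcomp Require Import all_boot all_order all_algebra.
From mathcomp Require Import freeg zify ring lra.
From mathcomp Require Import boolp reals.

Set Implicit Arguments.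
Unset Strict Implicit.
Unset Printing Implicit Defensive.

Import Order.TTheory GRing.Theory Num.Theory.

Local Open Scope ring_scope.

(** * The Weyl group *)

(** The obstacle is that W may be infinite and is given only as a group of linear maps: descents,
    exchange and Matsumoto's theorem have to be drawn from the signs of the roots. The braid
    relations of its left multiplications come from their commuting with the right multiplications,
    and this commutation rests on q_i = q_j for conjugate r_i and r_j. Conjugacy reduces to chains
    of bonds 3, where the parameters are identified. The other identification, q'_i = q_i when
    alpha_i takes an odd value on Y, is what the Yang-Baxter equations for the bonds 3, 4 and 6
    require. The argument therefore runs over a commutative ring K with families q, q' having these
    two properties, and R_1 is plugged in at the end. Fractions over R_1[Y] are never formed: a
    nonzerodivisor is an element of R_1[Y] acting injectively on the module, and a denominator is
    kept as a left factor. *)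

Section WeylGroup.
Variables (R : realType) (V : vectType R) (I : finType) (D : root_datum V I).

Lemma weyl_mulA : associative (@weyl_mul R V I D).
Proof. by move=> u v w; apply: val_inj; rewrite /= comp_lfunA. Qed.

Lemma weyl_mul1l : left_id (weyl1 D) (@weyl_mul R V I D).
Proof. by move=> w; apply: val_inj; rewrite /= comp_lfun1l. Qed.

Lemma weyl_mul1r : right_id (weyl1 D) (@weyl_mul R V I D).
Proof. by move=> w; apply: val_inj; rewrite /= comp_lfun1r. Qed.

Definition weyl_invg (w : weyl_type D) : weyl_type D :=
  exist _ (val w)^-1%VF (asboolT (weyl_inv (asboolW (valP w)))).

Lemma weyl_mulVl : left_inverse (weyl1 D) weyl_invg (@weyl_mul R V I D).
Proof.
move=> w; apply: val_inj => /=; apply: lker0_compVf.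
have [s sw] := in_weyl_word (asboolW (valP w)); apply/lker0P => x y exy.
have E := weyl_word_rev D (rev s); rewrite revK sw in E.
by rewrite -[x]id_lfunE -[y]id_lfunE -E !comp_lfunE exy.
Qed.

Lemma weyl_mulVr : right_inverse (weyl1 D) weyl_invg (@weyl_mul R V I D).
Proof.
move=> w; rewrite -[LHS]weyl_mul1l -(weyl_mulVl (weyl_invg w)).
by rewrite -weyl_mulA (weyl_mulA _ w) weyl_mulVl weyl_mul1l.
Qed.

HB.instance Definition _ := isGroup.Build (weyl_type D)
  weyl_mulA weyl_mul1l weyl_mul1r weyl_mulVl weyl_mulVr.

End WeylGroup.

(* The lock keeps conversion from unfolding lengths to minimal word searches. *)
HB.lock Definition ell (R : realType) (V : vectType R) (I : finType)
  (D : root_datum V I) (w : weyl_type D) : nat := weyl_length w.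

Lemma ellE (R : realType) (V : vectType R) (I : finType) (D : root_datum V I)
  (w : weyl_type D) : weyl_length w = ell w.
Proof. by rewrite ell.unlock. Qed.

Section WeylLength.
Variables (R : realType) (V : vectType R) (I : finType) (D : root_datum V I).

Local Notation W := (weyl_type D).
Local Notation s := (weyl_s D).
Local Notation len w := (@ell R V I D w%g).
Local Open Scope group_scope.
Implicit Types (i j k : I) (u v w : W) (l : seq I).

Definition weyl_prod l : W := foldr (fun i w => s i * w) 1 l.

Lemma val_weyl_prod l : val (weyl_prod l) = weyl_word D l.
Proof. by elim: l => //= i l ->. Qed.

Lemma weyl_prod_cat l1 l2 : weyl_prod (l1 ++ l2) = weyl_prod l1 * weyl_prod l2.
Proof. by elim: l1 => [|i l1 IHl] /=; rewrite ?mul1g // IHl mulgA. Qed.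

Lemma weyl_ss i : s i * s i = 1.
Proof. by apply: val_inj; exact: refl_invol. Qed.

Lemma weyl_sK i : cancel (fun w => s i * w) (fun w => s i * w).
Proof. by move=> w; rewrite mulgA weyl_ss mul1g. Qed.

Lemma weyl_sKr i : cancel (fun w => w * s i) (fun w => w * s i).
Proof. by move=> w; rewrite -mulgA weyl_ss mulg1. Qed.

Lemma weyl_sV i : (s i)^-1 = s i.
Proof. by rewrite -[LHS]mul1g -(weyl_ss i) mulgK. Qed.

Lemma weyl_prod_rev l : weyl_prod (rev l) = (weyl_prod l)^-1.
Proof.
elim: l => [|i l IHl]; first by rewrite invg1.
by rewrite rev_cons -cats1 weyl_prod_cat IHl /= mulg1 invgM weyl_sV.
Qed.

Lemma has_wordP w n :
  reflect (exists2 l, size l = n & weyl_prod l = w) (has_word w n).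
Proof.
apply: (iffP existsP) => [[t /eqP tw]|[l /eqP sl lw]].
  exists t; first exact: size_tuple.
  by apply: val_inj; rewrite val_weyl_prod.
by exists (Tuple sl); rewrite -lw val_weyl_prod.
Qed.

Lemma weyl_reduced_word w : exists l, weyl_prod l = w /\ size l = len w.
Proof.
rewrite -ellE /weyl_length; case: ex_minnP => n /has_wordP[l sl lw] _.
by exists l.
Qed.

Lemma ell_prod l : (len (weyl_prod l) <= size l)%N.
Proof.
rewrite -ellE /weyl_length; case: ex_minnP => n _; apply.
by apply/has_wordP; exists l.
Qed.

Lemma ell1 : len 1 = 0%N.
Proof. by apply/eqP; rewrite -leqn0; exact: (ell_prod [::]). Qed.

Lemma ell_sl i w : (len (s i * w) <= (len w).+1)%N.
Proof. by have [l [<- <-]] := weyl_reduced_word w; exact: (ell_prod (i :: l)). Qed.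

Lemma ell_sl_ge i w : (len w <= (len (s i * w)).+1)%N.
Proof. by rewrite -{1}[w](weyl_sK i) ell_sl. Qed.

Lemma ell_eq0 w : len w = 0%N -> w = 1.
Proof. by have [l [<- <-]] := weyl_reduced_word w => /size0nil ->. Qed.

Lemma ell_prod_cat l w : (len (weyl_prod l * w) <= size l + len w)%N.
Proof.
by have [l' [<- <-]] := weyl_reduced_word w; rewrite -weyl_prod_cat -size_cat ell_prod.
Qed.

Lemma weyl_left_descent w : w <> 1 -> exists i, (len (s i * w) < len w)%N.
Proof.
have [[|i l] [wE lE]] := weyl_reduced_word w; first by rewrite -wE.
exists i; rewrite -lE -wE /= weyl_sK; exact: ell_prod.
Qed.

Lemma ellV w : len w^-1 = len w.
Proof.
wlog suff H : w / (len w^-1 <= len w)%N.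
  by apply/eqP; rewrite eqn_leq H -{1}[w]invgK H.
have [l [<- <-]] := weyl_reduced_word w.
by rewrite -weyl_prod_rev -size_rev ell_prod.
Qed.

Lemma ell_sr i w : len (w * s i) = len (s i * w^-1).
Proof. by rewrite -ellV invgM weyl_sV. Qed.

Fixpoint alt i j n : W := if n is n'.+1 then s i * alt j i n' else 1.

Fixpoint alt_seq i j n : seq I := if n is n'.+1 then i :: alt_seq j i n' else [::].

Lemma size_alt_seq i j n : size (alt_seq i j n) = n.
Proof. by elim: n i j => //= n IHn i j; rewrite IHn. Qed.

Lemma weyl_prod_alt i j n : weyl_prod (alt_seq i j n) = alt i j n.
Proof. by elim: n i j => //= n IHn i j; rewrite IHn. Qed.

(* The letter that comes after the first [n] letters of [i j i j ...]. *)
Definition alt_next i j n := if odd n then j else i.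

Lemma alt_nextS i j n : alt_next j i n = alt_next i j n.+1.
Proof. by rewrite /alt_next /=; case: odd. Qed.

Lemma altS i j n : alt i j n.+1 = s i * alt j i n.
Proof. by []. Qed.

Lemma altSr i j n : alt i j n.+1 = alt i j n * s (alt_next i j n).
Proof.
elim: n i j => [|n IHn] i j; first by rewrite /= mulg1 mul1g.
by rewrite [LHS]/= -/(alt j i n.+1) IHn mulgA (alt_nextS i j).
Qed.

Lemma altV i j n : (alt i j n)^-1 = alt (alt_next j i n) (alt_next i j n) n.
Proof.
elim: n i j => [|n IHn] i j; first exact: invg1.
by rewrite altSr invgM weyl_sV IHn (alt_nextS i j n) (alt_nextS j i n) -(alt_nextS j i).
Qed.

Lemma alt_cat i j m n :
  alt i j (m + n) = alt i j m * alt (alt_next i j m) (alt_next j i m) n.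
Proof.
elim: m i j => [|m IHm] i j; first by rewrite mul1g.
by rewrite addSn /= IHm mulgA (alt_nextS i j m) (alt_nextS j i m).
Qed.

Lemma ell_alt i j n w : (len (alt i j n * w) <= n + len w)%N.
Proof. by rewrite -weyl_prod_alt -{2}(size_alt_seq i j n) ell_prod_cat. Qed.

End WeylLength.

(** * Rank 2 computations: positivity of roots and the braid relation *)

Section Dihedral.
Variable R : realType.

(* [bond_spec x y m]: m is the order of r_i r_j (0 if infinite) when
   x = - alpha_i(alpha_j^vee) and y = - alpha_j(alpha_i^vee). *)
Inductive bond_spec : R -> R -> nat -> Prop :=
| Bond2 : bond_spec 0 0 2
| Bond3 : bond_spec 1 1 3
| Bond4l : bond_spec 1 2 4
| Bond4r : bond_spec 2 1 4
| Bond6l : bond_spec 1 3 6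
| Bond6r : bond_spec 3 1 6
| BondInf x y of 0 < x & 0 < y & 4 <= x * y : bond_spec x y 0.

(* Coordinates of (p alpha_i + q alpha_j) o r_j r_i r_j ... (n factors). *)
Fixpoint dihedral_root (x y p q : R) n : R * R :=
  if n is n'.+1 then dihedral_root y x (p * x - q) p n' else (p, q).

(** The inequality [2 * q <= x * p] is the invariant of the recursion: it gives p x - q >= x p / 2
    >= 0, and then x y >= 4 gives 2 p <= y (p x - q), which is the same inequality for the next
    pair. *)
Lemma dihedral_root_infinite (x y p q : R) n : 0 < x -> 0 < y -> 4 <= x * y ->
  0 <= p -> 0 <= q -> 2 * q <= x * p ->
  0 <= (dihedral_root x y p q n).1 /\ 0 <= (dihedral_root x y p q n).2.
Proof.
elim: n x y p q => [|n IHn] x y p q x0 y0 xy p0 q0 pq //.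
by rewrite /=; apply: IHn => //; rewrite 1?mulrC //; nra.
Qed.

Lemma dihedral_root_ge0 x y m n : bond_spec x y m -> (m = 0 \/ n < m)%N ->
  0 <= (dihedral_root x y 1 0 n).1 /\ 0 <= (dihedral_root x y 1 0 n).2.
Proof.
case=> {x y m} [||||||x y x0 y0 xy _]; last first.
  by apply: dihedral_root_infinite => //; rewrite ?mulr1 ?mulr0 // ltW.
all: case=> // nm; do 7?[case: n nm => [|n] nm //=; try by split; lra].
Qed.

(* v - p c_i - q c_j is the image of v under r_i r_j r_i ... (n factors),
   where s and t are the values of alpha_i and alpha_j at v. *)
Fixpoint dihedral_orbit (x y s t : R) n : R * R :=
  if n is n'.+1 then let: (q, p) := dihedral_orbit y x t s n' in (s - p + q * x, q)
  else (0, 0).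

(** This is the braid relation of r_i and r_j in coordinates. The components are exchanged because
    the word on the right starts with j, so that its first component belongs to c_j. *)
Lemma dihedral_orbit_bond x y m s t : bond_spec x y m ->
  dihedral_orbit x y s t m =
    ((dihedral_orbit y x t s m).2, (dihedral_orbit y x t s m).1).
Proof. by case=> //=; congr pair; ring. Qed.

End Dihedral.

(** * Signs of roots and descents *)

Section Roots.
Variables (R : realType) (V : vectType R) (I : finType) (D : root_datum V I).

Local Notation W := (weyl_type D).
Local Notation a := (simple_root D).
Local Notation ac := (simple_coroot D).
Local Notation s := (weyl_s D).
Local Notation len w := (@ell R V I D w%g).
Implicit Types (i j k : I) (u v w : W) (f g : 'Hom(V, R^o)).

Definition cartan i j : R := - a i (ac j).

(** The product of the two Cartan integers is 4 cos^2(pi / m) when r_i r_j has finite order m; the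
    values 0, 1, 2, 3 thus give m = 2, 3, 4, 6. *)
Definition bond i j : nat :=
  if cartan i j * cartan j i == 0 then 2%N
  else if cartan i j * cartan j i == 1 then 3%N
  else if cartan i j * cartan j i == 2 then 4%N
  else if cartan i j * cartan j i == 3 then 6%N else 0%N.

Lemma bond_sym i j : bond i j = bond j i.
Proof. by rewrite /bond [cartan j i * _]mulrC. Qed.

Lemma cartan_nat i j : i != j -> exists n : nat, cartan i j = n%:R.
Proof.
move=> ij; have [_ Cz _] := cartanP D; have /Cz[aZ a0] : j != i by rewrite eq_sym.
by apply/natrP; rewrite natrEint /cartan rpredN aZ oppr_ge0 a0.
Qed.

Lemma bondP i j : i != j -> bond_spec (cartan i j) (cartan j i) (bond i j).
Proof.
move=> ij; have [n En] := cartan_nat ij.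
have [m Em] : exists m : nat, cartan j i = m%:R by apply: cartan_nat; rewrite eq_sym.
have nm0 : (n == 0)%N = (m == 0)%N.
  have [_ _ C0] := cartanP D; rewrite -!(pnatr_eq0 R) -En -Em !oppr_eq0.
  by apply/eqP/eqP => /C0.
rewrite /bond En Em -natrM !eqr_nat pnatr_eq0 pnatr_eq1.
have [nm|nm] := ltnP (n * m) 4; last first.
  have n0 : (0 < n)%N by case: (n) nm.
  have m0 : (0 < m)%N by case: (m) nm; rewrite ?muln0.
  do 4![rewrite ifF; last by apply/negbTE; move: nm; case: eqP => // ->].
  by apply: BondInf; rewrite ?ltr0n // -natrM ler_nat.
case: n nm nm0 {En} => [|n]; case: m {Em} => [|m] nm nm0 //; first exact: Bond2.
have n3 : (n < 3)%N by nia.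
have m3 : (m < 3)%N by nia.
case: n n3 nm {nm0} => [|[|[|//]]] _; case: m m3 => [|[|[|//]]] _ //= _;
  by [exact: Bond3 | exact: Bond4l | exact: Bond4r | exact: Bond6l | exact: Bond6r].
Qed.

Lemma bond_gt1 i j : i != j -> bond i j = 0%N \/ (1 < bond i j)%N.
Proof. by move=> /bondP[]; by [left | right]. Qed.

Lemma refl_orbit i j (x : V) p q :
  val (s i) (x - p *: ac i - q *: ac j) =
  x - (a i x - p + q * cartan i j) *: ac i - q *: ac j.
Proof.
have a2 : a i (ac i) = 2 by case: (cartanP D).
rewrite /= reflE !linearB !linearZ_LR /= a2 /cartan.
rewrite [LHS]addrAC; congr (_ + _); rewrite -addrA -scalerDl.
by congr (_ + _ *: _); rewrite /GRing.scale /=; ring.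
Qed.

Lemma alt_orbit i j n (x : V) :
  let pq := dihedral_orbit (cartan i j) (cartan j i) (a i x) (a j x) n in
  val (alt D i j n) x = x - pq.1 *: ac i - pq.2 *: ac j.
Proof.
elim: n i j => [|n IHn] i j /=; first by rewrite id_lfunE !scale0r !subr0.
rewrite comp_lfunE IHn; case: dihedral_orbit => q p /=.
by rewrite addrAC; exact: refl_orbit.
Qed.

Lemma alt_bond i j : i != j -> alt D i j (bond i j) = alt D j i (bond i j).
Proof.
move=> ij; apply: val_inj; apply/lfunP => v; rewrite !alt_orbit.
rewrite (dihedral_orbit_bond _ _ (bondP ij)).
by case: (dihedral_orbit _ _ _ _ _) => p q; rewrite addrAC.
Qed.

Lemma simple_rootB i j (x : V) p : a i (x - p *: ac j) = a i x + p * cartan i j.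
Proof. by rewrite linearB linearZ_LR /cartan mulrN /GRing.scale. Qed.

Lemma form_refl i j p q :
  ((p *: a i + q *: a j) \o val (s j))%VF =
  (p * cartan i j - q) *: a j + p *: a i.
Proof.
have a2 : a j (ac j) = 2 by case: (cartanP D).
apply/lfunP => v; rewrite comp_lfunE !add_lfunE !scale_lfunE /= reflE.
rewrite !simple_rootB /cartan a2 /GRing.scale /=.
by move: (a i v : R) (a j v : R) (a i (ac j) : R) => x y z; ring.
Qed.

Lemma form_alt i j p q n :
  let pq := dihedral_root (cartan i j) (cartan j i) p q n in
  ((p *: a i + q *: a j) \o val (alt D j i n))%VF =
  pq.1 *: a (alt_next i j n) + pq.2 *: a (alt_next j i n).
Proof.
elim: n i j p q => [|n IHn] i j p q /=; first by rewrite comp_lfun1r.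
by rewrite comp_lfunA form_refl IHn (alt_nextS i j n) (alt_nextS j i n).
Qed.

(** This is the root w^-1 alpha_i. Its sign will decide whether r_i is a left descent of w. *)
Definition root_form i w : 'Hom(V, R^o) := (a i \o val w)%VF.

Lemma root_formM i v w : root_form i (v * w)%g = (root_form i v \o val w)%VF.
Proof. exact: comp_lfunA. Qed.

Lemma root_form_sl i w : root_form i (s i * w)%g = - root_form i w.
Proof.
have a2 : a i (ac i) = 2 by case: (cartanP D).
rewrite root_formM /root_form -comp_lfunNl; congr (_ \o _)%VF.
apply/lfunP => x; rewrite comp_lfunE opp_lfunE /= reflE simple_rootB /cartan a2.
by move: (a i x : R) => y; ring.
Qed.

Lemma root_form_alt i j n w : i != j -> bond i j = 0%N \/ (n < bond i j)%N ->
  exists p q : R, [/\ 0 <= p, 0 <= q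
    & root_form i (alt D j i n * w)%g =
      p *: root_form (alt_next i j n) w + q *: root_form (alt_next j i n) w].
Proof.
move=> ij nm; have [p0 q0] := dihedral_root_ge0 (bondP ij) nm.
have := form_alt i j 1 0 n; rewrite scale1r scale0r addr0 => E.
do 2!eexists; split; [exact: p0 | exact: q0 |].
by rewrite root_formM /root_form E comp_lfunDl !comp_lfunZl.
Qed.

Lemma root_form_neq0 i w : root_form i w <> 0.
Proof.
have a2 : a i (ac i) = 2 by case: (cartanP D).
move=> /lfunP/(_ (val (w^-1)%g (ac i))); rewrite /root_form comp_lfunE zero_lfunE.
rewrite -[val w _]comp_lfunE.
have -> : (val w \o val (w^-1)%g)%VF = \1%VF by exact: (congr1 val (mulgV w)).
by rewrite id_lfunE a2 => /eqP; rewrite pnatr_eq0.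
Qed.

Lemma simple_root_indep (p : I -> R) :
  \sum_k p k *: a k = 0 -> forall k, p k = 0.
Proof.
move=> p0 k; have /freeP fr := simple_root_free D.
rewrite -[k]enum_rankK; apply: (fr (fun n => p (enum_val n))).
rewrite -[RHS]p0 (reindex (fun m : 'I_#|I| => enum_val m)); last first.
  exact: (onW_bij _ (@enum_val_bij I)).
by apply: eq_bigr => m _; rewrite nth_codom.
Qed.

Definition nonneg_form f := exists2 p : I -> R, forall k, 0 <= p k & f = \sum_k p k *: a k.

Lemma nonneg_form_root i : nonneg_form (a i).
Proof.
exists (fun k => (k == i)%:R) => [k|]; first exact: ler0n.
by rewrite (bigD1 i) //= eqxx scale1r big1 ?addr0 // => k /negPf ->; rewrite scale0r.
Qed.

Lemma nonneg_formD f g : nonneg_form f -> nonneg_form g -> nonneg_form (f + g).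
Proof.
move=> [p p0 ->] [q q0 ->]; exists (fun k => p k + q k) => [k|]; first exact: addr_ge0.
by rewrite -big_split; apply: eq_bigr => k _; rewrite scalerDl.
Qed.

Lemma nonneg_formZ p f : 0 <= p -> nonneg_form f -> nonneg_form (p *: f).
Proof.
move=> p0 [q q0 ->]; exists (fun k => p * q k) => [k|]; first exact: mulr_ge0.
by rewrite scaler_sumr; apply: eq_bigr => k _; rewrite scalerA.
Qed.

Lemma nonneg_form_eq0 f : nonneg_form f -> nonneg_form (- f) -> f = 0.
Proof.
move=> [p p0 ->] [q q0 Npq].
have pq0 k : p k + q k = 0.
  apply: (@simple_root_indep (fun k => p k + q k)).
  transitivity (\sum_k p k *: a k + \sum_k q k *: a k); last by rewrite -Npq addrN.
  by rewrite -big_split; apply: eq_bigr => j _; rewrite scalerDl.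
rewrite big1 // => k _; suff -> : p k = 0 by rewrite scale0r.
by apply/eqP; move/eqP: (pq0 k); rewrite paddr_eq0 // => /andP[].
Qed.

(* The left descents of [w] are peeled off alternately among [j] and [i] as
   long as possible. *)
Lemma weyl_alt_descent i j w n : (len w <= n)%N ->
  exists m v, [/\ w = alt D j i m * v, len w = (m + len v)%N
    & (len v <= len (s (alt_next j i m) * v))%N]%g.
Proof.
elim: n i j w => [|n IHn] i j w wn.
  by exists 0%N, w; rewrite mul1g; split=> //; apply: leq_trans wn _.
have [wj|jw] := leqP (len w) (len (s j * w)).
  by exists 0%N, w; rewrite mul1g.
have [|m [v [E lE le]]] := IHn j i (s j * w)%g; first by rewrite -ltnS (leq_trans jw).
exists m.+1, v; split.
- by rewrite altS -mulgA -E weyl_sK.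
- by apply: anti_leq; rewrite addSn -lE jw ell_sl_ge.
- by rewrite -alt_nextS.
Qed.

(** Induction on the length. Choose a left descent j of w and write w = (r_j r_i ...) v, with
    lengths adding up and neither r_i nor r_j shortening v. The rank 2 computation makes alpha_i o w
    a nonnegative combination of alpha_i o v and alpha_j o v, to which the induction applies. *)
Theorem nonneg_root_form i w : (len w <= len (s i * w))%N -> nonneg_form (root_form i w).
Proof.
have [n] := ubnP (len w); elim: n i w => // n IHn i w wn iw.
have [w1|/weyl_left_descent[j jw]] := pselect (w = 1%g).
  by rewrite w1 /root_form comp_lfun1r; exact: nonneg_form_root.
have ij : i != j by apply: contraTneq jw => <-; rewrite -leqNgt.
have [m [v [wE lE vm]]] := weyl_alt_descent i j (leqnn (len w)).
have m0 : (0 < m)%N.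
  case: m wE vm {lE} => // wE; rewrite /alt_next /= leqNgt => /negP[].
  by rewrite -[v]mul1g -wE.
(* If the alternating prefix were as long as the bond, the braid relation would let it start with
   r_i, and r_i would shorten w. *)
have mb : bond i j = 0%N \/ (m < bond i j)%N.
  have [/eqP b0|b0] := boolP (bond i j == 0)%N; [by left | right].
  rewrite ltnNge; apply/negP => bm; move: iw; rewrite leqNgt => /negP; apply.
  have [b bE] : exists b, bond i j = b.+1 by case: (bond i j) b0 => // b; exists b.
  have E : (s i * w = alt D j i b *
      (alt D (alt_next j i b.+1) (alt_next i j b.+1) (m - b.+1) * v))%g.
    rewrite wE -{1}(subnKC bm) bE alt_cat -bE -(alt_bond ij) bE altS.
    by rewrite -!mulgA weyl_sK.
  rewrite E lE -{2}(subnKC bm) bE addSn addSn ltnS -addnA.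
  apply: leq_trans (ell_alt _ _ _ _) _.
  by rewrite leq_add2l ell_alt.
have [p [q [p0 q0 E]]] := root_form_alt v ij mb; rewrite wE E.
have vw : (len v < n)%N.
  by rewrite -ltnS; apply: leq_ltn_trans wn; rewrite lE -add1n leq_add2r.
(* The letter removed last does not shorten v, since otherwise w itself would be shorter; [vm]
   covers the other letter. *)
have last_ge : (len v <= len (s (alt_next i j m) * v))%N.
  case: m m0 wE lE {vm mb E} => // m _ wE lE.
  have := ell_alt j i m (s (alt_next j i m) * v)%g.
  rewrite mulgA -altSr -wE lE addSnnS leq_add2l (alt_nextS i j m).
  exact: ltnW.
apply: nonneg_formD; apply: nonneg_formZ; [exact: p0 | | exact: q0 |].
  exact: IHn vw last_ge.
exact: IHn vw vm.
Qed.

(** With equal lengths, [nonneg_root_form] applies to both w and r_i w, so that a root and its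
    opposite are both nonnegative and the root vanishes. *)
Lemma ell_sl_neq i w : len (s i * w) <> len w.
Proof.
move=> E; apply: (@root_form_neq0 i w); apply: nonneg_form_eq0.
  by apply: nonneg_root_form; rewrite E.
rewrite -root_form_sl; apply: nonneg_root_form; rewrite weyl_sK E; exact: leqnn.
Qed.

Lemma ell_sl_lt i w :
  (len (s i * w) < len w)%N = ~~ (len w < len (s i * w))%N.
Proof. by have := @ell_sl_neq i w; case: ltngtP. Qed.

Lemma nonneg_root_form_iff i w :
  nonneg_form (root_form i w) <-> (len w < len (s i * w))%N.
Proof.
split=> [f0|/ltnW]; last exact: nonneg_root_form.
rewrite -[(_ < _)%N]negbK -ell_sl_lt; apply/negP => iw.
apply: (@root_form_neq0 i w); apply: nonneg_form_eq0 => //.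
by rewrite -root_form_sl; apply: nonneg_root_form; rewrite weyl_sK ltnW.
Qed.

Lemma nonpos_root_form_iff i w :
  nonneg_form (- root_form i w) <-> (len (s i * w) < len w)%N.
Proof. by rewrite -root_form_sl nonneg_root_form_iff weyl_sK. Qed.

(* As [bond] is 0 when r_i r_j has infinite order, common left descents generate
   a finite group. *)
Lemma two_left_descents i j u : i != j ->
  (len (s i * u) < len u)%N -> (len (s j * u) < len u)%N ->
  exists v, [/\ (1 < bond i j)%N, (u = alt D i j (bond i j) * v)%g
    & len u = (bond i j + len v)%N].
Proof.
move=> ij iu ju.
(* After n letters of the alternating word are removed from u, the root of the next letter at v is a
   nonnegative combination of alpha_i o u and alpha_j o u. Both are nonpositive, so that this letter
   is again a descent. *)
have strip n : bond i j = 0%N \/ (n <= bond i j)%N ->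
    exists v, (u = alt D i j n * v)%g /\ len u = (n + len v)%N.
  elim: n => [|n IHn] nb; first by exists u; rewrite mul1g.
  have [|v [uE lE]] := IHn; first by case: nb => [|/ltnW]; by [left|right].
  pose b := alt_next i j n.
  have bv : (len (s b * v) < len v)%N.
    apply/nonpos_root_form_iff.
    have vE : v = (alt D (alt_next j i n) b n * u)%g by rewrite -altV uE mulKg.
    have nonpos k : k = i \/ k = j -> nonneg_form (- root_form k u).
      by case=> ->; apply/nonpos_root_form_iff.
    have [bj bb bb'] : [/\ b != alt_next j i n, bond b (alt_next j i n) = bond i j
        & forall m, (alt_next b (alt_next j i n) m = i \/ alt_next b (alt_next j i n) m = j) /\
           (alt_next (alt_next j i n) b m = i \/ alt_next (alt_next j i n) b m = j)].
      rewrite /b /alt_next; case: (odd n); split=> //; rewrite 1?[LHS]bond_sym 1?[_ == _]eq_sym //;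
        by move=> m; case: (odd m); auto.
    have [|p [q [p0 q0 E]]] := root_form_alt u bj (n := n).
      by rewrite bb; case: nb; by [left|right].
    have [b1 b2] := bb' n.
    rewrite vE E opprD -!scalerN.
    by apply: nonneg_formD; apply: nonneg_formZ => //; apply: nonpos.
  exists (s b * v)%g; split.
    by rewrite altSr mulgA -(mulgA _ (s b) (s b)) weyl_ss mulg1.
  rewrite lE addSnnS; congr addn; apply: anti_leq.
  by rewrite ell_sl_ge bv.
(* With bond 0 there would be no limit to the stripping, and more letters than [len u] would come
   off. *)
have b1 : (1 < bond i j)%N.
  have [b0|//] := bond_gt1 ij.
  have [|v [_]] := strip (len u).+1; first by left.
  by move=> E; move: (leq_addr (len v) (len u).+1); rewrite -E ltnn.
by have [|v [uE lE]] := strip (bond i j); [right | exists v].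
Qed.
End Roots.

(** * Exchange condition and conjugacy of simple reflections *)

Section Exchange.
Variables (R : realType) (V : vectType R) (I : finType) (D : root_datum V I).

Local Notation W := (weyl_type D).
Local Notation a := (simple_root D).
Local Notation ac := (simple_coroot D).
Local Notation s := (weyl_s D).
Local Notation len w := (@ell R V I D w%g).
Implicit Types (i j k : I) (u v w : W) (f g : 'Hom(V, R^o)) (l : seq I).

Lemma form_s f j : (f \o val (s j))%VF = f - f (ac j) *: a j.
Proof.
apply/lfunP => x; rewrite comp_lfunE add_lfunE opp_lfunE scale_lfunE /= reflE linearB linearZ_LR /=.
by congr (_ - _); rewrite /GRing.scale /= mulrC.
Qed.

Lemma form_indep f g k (p q : I -> R) (t : R) j : j != k ->
  f = \sum_k p k *: a k -> g = \sum_k q k *: a k -> f + g = t *: a j -> p k + q k = 0.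
Proof.
move=> jk -> -> E.
suff /(_ k) : forall k, p k + q k - (k == j)%:R * t = 0.
  by rewrite eq_sym (negPf jk) mul0r subr0.
apply: (@simple_root_indep _ _ _ D (fun k => p k + q k - (k == j)%:R * t)).
transitivity (\sum_k p k *: a k + \sum_k q k *: a k - t *: a j); last by rewrite E addrN.
have -> : t *: a j = \sum_k ((k == j)%:R * t) *: a k.
  rewrite (bigD1 j) //= eqxx mul1r big1 ?addr0 // => m /negPf ->.
  by rewrite mul0r scale0r.
rewrite -big_split -sumrB; apply: eq_bigr => m _.
by rewrite scalerBl scalerDl.
Qed.

Lemma weyl_eq1 w : (forall k, nonneg_form D (root_form k w)) -> w = 1%g.
Proof.
move=> pos; have [//|/weyl_left_descent[k]] := pselect (w = 1%g).
by rewrite ell_sl_lt => /negP[]; apply/nonneg_root_form_iff.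
Qed.

(** A form of the exchange condition: a positive root that becomes negative under r_j is a multiple
    of alpha_j, which makes the reflections r_i and w r_j w^-1 equal. *)
Lemma folding i j w : (len w < len (s i * w))%N ->
  (len (s i * (w * s j)) < len (w * s j))%N -> (s i * w = w * s j)%g.
Proof.
move=> /nonneg_root_form_iff[p p0 fE] /nonpos_root_form_iff[q q0].
rewrite root_formM form_s opprB => gE.
(* [f] and its image under r_j have opposite signs but differ by a multiple of alpha_j; all other
   coefficients of [f] therefore vanish. *)
pose f := root_form i w; have fj : f = p j *: a j.
  rewrite /f fE (bigD1 j) //= big1 ?addr0 // => k kj.
  suff -> : p k = 0 by rewrite scale0r.
  have jk : j != k by rewrite eq_sym.
  have E : f + (f (ac j) *: a j - f) = f (ac j) *: a j by rewrite addrC subrK.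
  by apply/eqP; move/eqP: (form_indep jk fE gE E); rewrite paddr_eq0 // => /andP[].
have a2 k : a k (ac k) = 2 by case: (cartanP D).
(* [x] moves each alpha_k by a multiple of alpha_j and fixes alpha_j. It is shown to make no simple
   root negative, which forces it to be 1. *)
pose x := (w^-1 * s i * w * s j)%g; suff : x = 1%g.
  have <- : (w * x * s j = s i * w)%g by rewrite /x !mulgA mulgV mul1g weyl_sKr.
  by move=> ->; rewrite mulg1.
pose t k : R := (root_form k w^-1)%g (ac i) * p j.
have wVw k : (root_form k w^-1%g \o val w)%VF = a k.
  by rewrite -root_formM mulVg /root_form comp_lfun1r.
have sE k : root_form k (w^-1 * s i * w)%g = a k - t k *: a j.
  rewrite !root_formM form_s -scaleNr comp_lfunDl -comp_lfunZl wVw -/(root_form i w).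
  by rewrite -/f fj scalerA mulNr scaleNr.
have xE k : root_form k x = a k - (a k (ac j) - t k) *: a j.
  rewrite /x root_formM form_s sE add_lfunE opp_lfunE scale_lfunE a2.
  have -> : a k (ac j) - t k = t k + (a k (ac j) - t k * 2) by ring.
  by rewrite [in RHS]scalerDl opprD addrA.
have tj : t j = 2.
  have E1 : f (val (w^-1)%g (ac i)) = 2.
    by rewrite -comp_lfunE -root_formM mulgV /root_form comp_lfun1r a2.
  by rewrite -E1 fj scale_lfunE /t comp_lfunE; exact: mulrC.
apply: weyl_eq1 => k; have [kj|jk] := eqVneq j k.
  rewrite -kj xE a2 tj subrr scale0r subr0; exact: nonneg_form_root.
(* For k different from j the coefficient of alpha_k in alpha_k o x is 1, so that this form cannot
   be nonpositive. *)
have [/ltnW/nonneg_root_form //|] := boolP (len x < len (s k * x))%N.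
rewrite -ell_sl_lt => /nonpos_root_form_iff[q' q0' gE'].
have hE : a k = \sum_m (m == k)%:R *: a m.
  rewrite (bigD1 k) //= eqxx scale1r big1 ?addr0 // => m /negPf ->.
  by rewrite scale0r.
have := form_indep jk hE gE'; rewrite xE opprB addrC subrK => /(_ _ erefl).
by rewrite eqxx => /eqP; rewrite paddr_eq0 ?oner_eq0 // ler01.
Qed.

Lemma folding_descent i j w : (s i * w <> w * s j)%g ->
  (len (s i * (w * s j)) < len (w * s j))%N = (len (s i * w) < len w)%N.
Proof.
move=> NE; apply/idP/idP => [lt|lt]; rewrite ell_sl_lt; apply/negP => gt; apply: NE.
  exact: folding gt lt.
have := @folding i j _ gt; rewrite weyl_sKr => /(_ lt) E.
by rewrite -{1}E weyl_sK.
Qed.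

Lemma folding_descent_r i j w : (s i * w <> w * s j)%g ->
  (len (s i * w * s j) < len (s i * w))%N = (len (w * s j) < len w)%N.
Proof.
move=> NE; have : (s j * w^-1 <> w^-1 * s i)%g.
  by move=> E; apply: NE; apply: invg_inj; rewrite !invgM !weyl_sV E.
have e1 : len (s j * (w^-1 * s i)) = len (s i * w * s j).
  by rewrite -ellV !invgM invgK !weyl_sV.
have e2 : len (w^-1 * s i) = len (s i * w) by rewrite -ellV invgM invgK weyl_sV.
have e3 : len (s j * w^-1) = len (w * s j) by rewrite -ellV invgM invgK weyl_sV.
by move=> /folding_descent; rewrite e1 e2 e3 ellV.
Qed.


(** If r_i = r_j with i different from j, this element of length at most 1 would have two distinct
    left descents, hence length at least the bond, which exceeds 1. *)
Lemma weyl_s_inj : injective s.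
Proof.
move=> i j ij; apply/eqP; apply: contraT => nij.
have l1 : (len (s i) <= 1)%N by have := @ell_sl _ _ _ D i 1%g; rewrite ell1 mulg1.
have si k : s k = s i -> (len (s k * s i) < len (s i))%N.
  move=> <-; rewrite weyl_ss ell1 lt0n; apply/eqP => /ell_eq0 k1.
  by apply: (@ell_sl_neq _ _ _ D k 1%g); rewrite k1 mulg1.
have [v [b1 _ lE]] := two_left_descents nij (si i erefl) (si j (esym ij)).
by move: l1; rewrite lE leqNgt (leq_trans b1) // leq_addr.
Qed.

Lemma bond_odd i j : i != j -> odd (bond D i j) -> bond D i j = 3%N.
Proof. by move=> /bondP[]. Qed.

(* Simple reflections are conjugate only when they are linked by a chain of
   odd bonds. *)
Lemma conj_invariant (T : Type) (q : I -> T) :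
  (forall i j, i != j -> bond D i j = 3%N -> q i = q j) ->
  forall i j w, (s i * w = w * s j)%g -> q i = q j.
Proof.
move=> q3 i j w; have [n] := ubnP (len w); elim: n i j w => // n IHn i j w wn E.
have [iw|wi] := boolP (len (s i * w) < len w)%N.
  apply: (IHn i j (s i * w)%g); first by rewrite -ltnS (leq_trans _ wn).
  by rewrite -mulgA -E.
move: wi; rewrite ell_sl_lt negbK => wi.
have [w1|/weyl_left_descent[k kw]] := pselect (w = 1%g).
  by move: E; rewrite w1 mulg1 mul1g => /weyl_s_inj ->.
have ik : i != k by apply: contraTneq kw => <-; rewrite -leqNgt ltnW.
pose u := (s i * w)%g; have iu : (len (s i * u) < len u)%N by rewrite weyl_sK.
have ku : (len (s k * u) < len u)%N.
  apply: leq_ltn_trans wi; rewrite /u E mulgA ell_sr; apply: leq_trans (ell_sl _ _) _.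
  by rewrite ellV.
have [v [b1 uE lE]] := two_left_descents ik iu ku.
have [m bE] : exists m, bond D i k = m.+1 by case: (bond D i k) b1 => // m; exists m.
pose x := alt_next k i m.
(* Cancelling all but one letter of the alternating prefix turns the conjugation by w into one by
   the shorter element v. *)
have vx : (s x * v = v * s j)%g.
  apply: (mulgI (alt D k i m)); rewrite mulgA -altSr mulgA -bE -(alt_bond D ik).
  rewrite -uE /u E; congr (_ * _)%g.
  by rewrite -[LHS](weyl_sK i) -/u uE bE altS -mulgA weyl_sK.
have lv : (len v < n)%N.
  have lw : (len u <= (len w).+1)%N by exact: ell_sl.
  by move: lw wn; rewrite lE bE addSn ltnS => lw wn; move: b1; rewrite bE; lia.
(* For an even bond the new letter x is i itself; for an odd one it is k, and the bond of i and k is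
   then 3. *)
rewrite -(IHn _ _ _ lv vx) /x /alt_next; case: ifP => // om.
by apply: q3 => //; apply: bond_odd => //; rewrite bE /= om.
Qed.

(** * Matsumoto's theorem for products in a ring *)

Section Matsumoto.
Variables (A : pzRingType) (f : I -> A).
Hypothesis f_braid : forall i j, i != j -> (1 < bond D i j)%N ->
  \prod_(k <- alt_seq i j (bond D i j)) f k = \prod_(k <- alt_seq j i (bond D i j)) f k.

(** A common first letter is cancelled. If the first letters i and j differ, both are left descents,
    so that the element is the full alternating word in i, j times some v. Induction compares each
    word with the alternating word having the same first letter, followed by a reduced word of v;
    these two are related by [f_braid]. *)
Lemma matsumoto l1 l2 : weyl_prod D l1 = weyl_prod D l2 ->
  size l1 = len (weyl_prod D l1) -> size l2 = len (weyl_prod D l2) ->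
  \prod_(k <- l1) f k = \prod_(k <- l2) f k.
Proof.
have [n] := ubnP (size l1); elim: n l1 l2 => // n IHn [|i l1] [|j l2] //= ln E.
- by rewrite -E ell1.
- by rewrite E ell1.
have tl k l : (size l).+1 = len (s k * weyl_prod D l) -> size l = len (weyl_prod D l).
  move=> lE; apply/eqP; rewrite eqn_leq ell_prod andbT -ltnS lE; exact: ell_sl.
have desc k l : (size l).+1 = len (s k * weyl_prod D l) ->
    (len (s k * (s k * weyl_prod D l)) < len (s k * weyl_prod D l))%N.
  by move=> lE; rewrite weyl_sK -lE ltnS -(tl _ _ lE).
move=> li lj; rewrite !big_cons; have [ij|ij] := eqVneq i j.
  rewrite ij in E li *; congr (_ * _); apply: IHn => //.
  - by apply: (mulgI (s j)).
  - exact: tl li.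
  - exact: tl lj.
pose u := (s i * weyl_prod D l1)%g; have ju := desc _ _ lj; rewrite -E -/u in ju.
have [v [b1 uE lE]] := two_left_descents ij (desc _ _ li) ju.
have [m bE] : exists m, bond D i j = m.+1 by case: (bond D i j) b1 => // m; exists m.
have [r [rE rl]] := weyl_reduced_word v.
have IH k k' l : (s k * weyl_prod D l)%g = u -> (size l < n)%N ->
    (size l).+1 = len u -> (u = alt D k k' m.+1 * v)%g ->
    f k * \prod_(i <- l) f i = \prod_(i <- alt_seq k k' m.+1) f i * \prod_(i <- r) f i.
  move=> lu ln' lE' uE'; rewrite /= big_cons -mulrA -big_cat; congr (_ * _).
  have wE : weyl_prod D l = weyl_prod D (alt_seq k' k m ++ r).
    apply: (mulgI (s k)); rewrite lu uE' weyl_prod_cat weyl_prod_alt rE altS.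
    by rewrite mulgA.
  have sl : size l = len (weyl_prod D l) by apply: (tl k); rewrite lu.
  apply: IHn => //; rewrite -wE -sl size_cat size_alt_seq rl.
  by move: lE; rewrite bE -/u -lE' addSn => -[->].
have ln2 : (size l2 < n)%N.
  by move: li lj; rewrite E => <- [->].
rewrite (IH i j l1) //; last by rewrite -bE.
rewrite (IH j i l2) //; last by rewrite -bE -(alt_bond D ij).
  by rewrite -bE f_braid.
by rewrite lj -E.
Qed.

Definition reduced_word w : seq I := sval (cid (weyl_reduced_word w)).

Lemma prod_reduced_word w : weyl_prod D (reduced_word w) = w.
Proof. by rewrite /reduced_word; case: cid => l []. Qed.

Lemma size_reduced_word w : size (reduced_word w) = len w.
Proof. by rewrite /reduced_word; case: cid => l []. Qed.

Definition weyl_lift w : A := \prod_(k <- reduced_word w) f k.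

Lemma weyl_lift_sl i w : (len w < len (s i * w))%N ->
  weyl_lift (s i * w)%g = f i * weyl_lift w.
Proof.
move=> iw; rewrite /weyl_lift.
have -> : f i * \prod_(k <- reduced_word w) f k = \prod_(k <- i :: reduced_word w) f k.
  by rewrite big_cons.
apply: matsumoto.
- by rewrite /= !prod_reduced_word.
- by rewrite prod_reduced_word size_reduced_word.
- rewrite /= prod_reduced_word size_reduced_word; apply/eqP.
  by rewrite eqn_leq iw ell_sl.
Qed.

Lemma weyl_lift1 : weyl_lift 1%g = 1.
Proof.
rewrite /weyl_lift; suff /size0nil -> : size (reduced_word 1%g) = 0%N by rewrite big_nil.
by rewrite size_reduced_word ell1.
Qed.

End Matsumoto.
End Exchange.

(** * Yang-Baxter equations *)

Section AlternatingProducts.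
Variables (B : comPzRingType) (A : pzRingType) (iota : {rmorphism B -> A}).
Variables (h : bool -> A) (q : bool -> B).
Hypothesis h_quad : forall b, h b * h b = iota (q b) * h b + 1.
Hypothesis h_comm : forall b x, h b * iota x = iota x * h b.

Fixpoint alt_prod b n : A := if n is n'.+1 then h b * alt_prod (~~ b) n' else 1.

Definition linear_factor (t : bool * (B * B)) : A := iota t.2.1 * h t.1 + iota t.2.2.

Definition alt_comb n (ce : B * (bool -> nat -> B)) : A :=
  iota ce.1 + \sum_(k < n) (iota (ce.2 true k) * alt_prod true k.+1 +
                            iota (ce.2 false k) * alt_prod false k.+1).

(** Left multiplication by x h_b + y on the formal span of the alternating words: [c] is the
    coefficient of the empty word and [e b n] that of the word of n + 1 letters starting with b. The
    quadratic relation contracts h_b times a word starting with b; any other word is extended.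
    Identities between products of linear factors become identities in [B], which [ring] can
    decide. *)
Definition linear_step (t : bool * (B * B)) (ce : B * (bool -> nat -> B)) :
    B * (bool -> nat -> B) :=
  let: (b, (x, y)) := t in let: (c, e) := ce in
  (y * c + x * e b 0%N,
   fun b' n => if b' == b
     then y * e b n + x * ((if n is n'.+1 then e (~~ b) n' else c) + q b * e b n)
     else y * e (~~ b) n + x * e b n.+1).

Definition linear_coefs : seq (bool * (B * B)) -> B * (bool -> nat -> B) :=
  foldr linear_step (1, fun _ _ => 0).

Lemma alt_combE b n ce : alt_comb n ce =
  iota ce.1 + (\sum_(k < n) iota (ce.2 b k) * alt_prod b k.+1 +
               \sum_(k < n) iota (ce.2 (~~ b) k) * alt_prod (~~ b) k.+1).
Proof. by rewrite /alt_comb big_split; case: b; rewrite //= [X in _ + X]addrC. Qed.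

Lemma linear_stepE t n ce : (forall b k, (n <= k)%N -> ce.2 b k = 0) ->
  linear_factor t * alt_comb n ce = alt_comb n.+1 (linear_step t ce).
Proof.
case: t ce => [b [x y]] [c e] /= e0.
have hb k : h b * alt_prod b k.+1 = iota (q b) * alt_prod b k.+1 + alt_prod (~~ b) k.
  by rewrite /= mulrA h_quad mulrDl mul1r mulrA.
pose U := \sum_(k < n) iota (e b k) * alt_prod b k.+1.
pose W := \sum_(k < n) iota (e (~~ b) k) * alt_prod (~~ b) k.+1.
pose Q := \sum_(k < n) iota (q b * e b k) * alt_prod b k.+1.
pose P := \sum_(k < n) iota (e b k) * alt_prod (~~ b) k.
pose Z := \sum_(k < n) iota (e (~~ b) k) * alt_prod b k.+2.
have hU : h b * U = Q + P.
  rewrite mulr_sumr -big_split; apply: eq_bigr => k _.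
  by rewrite mulrA h_comm -mulrA hb mulrDr mulrA -rmorphM [e b k * _]mulrC.
have hW : h b * W = Z.
  rewrite mulr_sumr; apply: eq_bigr => k _.
  by rewrite mulrA h_comm -mulrA; congr (_ * _); rewrite /= negbK.
have S1 : \sum_(k < n.+1) iota (y * e b k +
      x * ((if nat_of_ord k is n'.+1 then e (~~ b) n' else c) + q b * e b k)) * alt_prod b k.+1 =
    iota y * U + iota x * (iota c * h b + (Z + Q)).
  have split3 (k : nat) u : iota (y * e b k + x * (u + q b * e b k)) * alt_prod b k.+1 =
      iota y * (iota (e b k) * alt_prod b k.+1) + iota x * (iota u * alt_prod b k.+1) +
      iota x * (iota (q b * e b k) * alt_prod b k.+1).
    by rewrite mulrDr addrA !rmorphD !mulrDl !rmorphM /= !mulrA.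
  under eq_bigr do rewrite split3.
  rewrite !big_split /= -!mulr_sumr big_ord_recr /= e0 // rmorph0 mul0r addr0.
  rewrite [X in _ + iota x * X = _]big_ord_recr /= e0 // mulr0 rmorph0 mul0r addr0.
  rewrite [X in _ + iota x * X + _ = _]big_ord_recl /= mulr1 -addrA -mulrDr.
  by rewrite -/Q -/U addrA.
(* The term k = 0 of [P] is the empty word. [linear_step] counts it in the constant coefficient,
   whence the subtraction. *)
have S2 : \sum_(k < n.+1) iota (y * e (~~ b) k + x * e b k.+1) * alt_prod (~~ b) k.+1 =
    iota y * W + iota x * (P - iota (e b 0%N)).
  under eq_bigr do rewrite rmorphD mulrDl !rmorphM -!mulrA.
  rewrite big_split /= -!mulr_sumr big_ord_recr /= e0 // rmorph0 mul0r addr0.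
  congr (_ + _ * _).
  have -> : P = \sum_(k < n.+2) iota (e b k) * alt_prod (~~ b) k.
    by rewrite !big_ord_recr /= !e0 // rmorph0 !mul0r !addr0.
  by rewrite [X in _ = X - _]big_ord_recl /= mulr1 [RHS]addrC addKr.
rewrite /linear_factor !(alt_combE b) /= eqxx (_ : (~~ b == b) = false); last by case: (b).
rewrite -/U -/W S1 S2.
rewrite mulrDl -mulrA !(mulrDr (h b)) h_comm hU hW rmorphD !rmorphM.
rewrite !mulrDr mulrN !mulrA !addrA [RHS](ACl (4*6*8*5*1*3*7*2*9))%AC /= addrK.
by [].
Qed.

Lemma linear_coefsE l :
  \prod_(t <- l) linear_factor t = alt_comb (size l) (linear_coefs l) /\
  (forall b k, (size l <= k)%N -> (linear_coefs l).2 b k = 0).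
Proof.
elim: l => [|t l [IH0 IH1]].
  by rewrite big_nil /alt_comb /= big_ord0 addr0 rmorph1.
rewrite big_cons IH0 linear_stepE //; split=> // b k.
rewrite /linear_coefs /= -/(linear_coefs l).
case: t (linear_coefs l) IH1 => [b' [x y]] [c e] /= e0; case: k => // k lk.
have e1 b1 k1 : (k <= k1)%N -> e b1 k1 = 0 by move=> kk; apply: e0; apply: leq_trans kk.
have k1 : (k <= k.+1)%N by []; have k2 : (k <= k.+2)%N by rewrite ltnW.
by case: eqP => _; rewrite !(e1 _ _ k1, e1 _ _ k2, e1 _ _ (leqnn k)) !(mulr0, addr0).
Qed.

(** The braid relation identifies the two longest alternating words, so that at the top only the
    sums of their coefficients have to agree. *)
Lemma linear_prod_eq l1 l2 : size l1 = size l2 ->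
  alt_prod true (size l1) = alt_prod false (size l1) ->
  let e1 := linear_coefs l1 in let e2 := linear_coefs l2 in
  let m := (size l1).-1 in
  e1.1 = e2.1 -> (forall b k, (k < m)%N -> e1.2 b k = e2.2 b k) ->
  e1.2 true m + e1.2 false m = e2.2 true m + e2.2 false m ->
  \prod_(t <- l1) linear_factor t = \prod_(t <- l2) linear_factor t.
Proof.
move=> s12 braid e1 e2 m E0 E1 E2.
have [-> _] := linear_coefsE l1; have [-> _] := linear_coefsE l2.
rewrite -s12 /alt_comb -/e1 -/e2 E0; congr (_ + _).
rewrite /m in E1 E2; case: (size l1) braid E1 E2 => [|n] braid E1 E2; first by rewrite !big_ord0.
rewrite !big_ord_recr /= -/(alt_prod true n.+1) -/(alt_prod false n.+1) braid -!mulrDl -!rmorphD E2.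
by congr (_ + _); apply: eq_bigr => k _; rewrite !E1.
Qed.

End AlternatingProducts.

Section YangBaxter.
Variables (B : comPzRingType) (A : pzRingType) (iota : {rmorphism B -> A}).
Variables (h : bool -> A) (q q' : bool -> B).
Hypothesis h_quad : forall b, h b * h b = iota (q b) * h b + 1.
Hypothesis h_comm : forall b x, h b * iota x = iota x * h b.

(** The Baxterized generator h_b - (q_b + q'_b x) / (1 - x^2) with spectral parameter x, its
    denominator cleared. *)
Definition yb_coef (t : bool * B) := (t.1, (1 - t.2 ^+ 2, - (q t.1 + q' t.1 * t.2))).

Definition yb_factor (t : bool * B) : A := linear_factor iota h (yb_coef t).

(* When q = q', the common scalar factor 1 + x of the coefficients is left out. *)
Lemma yb_factorE (t : bool * B) : q' t.1 = q t.1 ->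
  yb_factor t = iota (1 + t.2) * linear_factor iota h (t.1, (1 - t.2, - q t.1)).
Proof.
move=> qq; rewrite /yb_factor /linear_factor /= qq mulrDr mulrA -!rmorphM.
by congr (iota _ * _ + iota _); ring.
Qed.

Lemma linear_factorC t x :
  linear_factor iota h t * iota x = iota x * linear_factor iota h t.
Proof.
rewrite /linear_factor mulrDl mulrDr -mulrA h_comm !mulrA -!rmorphM.
by rewrite [t.2.1 * x]mulrC [t.2.2 * x]mulrC.
Qed.

Lemma yb_prodE l : q' true = q true -> q' false = q false ->
  \prod_(t <- l) yb_factor t = iota (\prod_(t <- l) (1 + t.2)) *
    \prod_(t <- [seq (t.1, (1 - t.2, - q t.1)) | t <- l]) linear_factor iota h t.
Proof.
move=> q1 q2; elim: l => [|t l IHl]; first by rewrite /= !big_nil rmorph1 mul1r.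
have t1 : q' t.1 = q t.1 by case: (t.1).
rewrite map_cons !big_cons IHl (yb_factorE t1).
rewrite [iota (_ * _)]rmorphM -[LHS]mulrA -[RHS]mulrA; congr (_ * _).
by rewrite mulrA linear_factorC mulrA.
Qed.

Lemma linear_map_prod_eq (f : bool * B -> bool * (B * B)) l1 l2 :
  size l1 = size l2 -> alt_prod h true (size l1) = alt_prod h false (size l1) ->
  let e1 := linear_coefs q (map f l1) in let e2 := linear_coefs q (map f l2) in
  let m := (size l1).-1 in
  e1.1 = e2.1 -> (forall b k, (k < m)%N -> e1.2 b k = e2.2 b k) ->
  e1.2 true m + e1.2 false m = e2.2 true m + e2.2 false m ->
  \prod_(t <- l1) linear_factor iota h (f t) = \prod_(t <- l2) linear_factor iota h (f t).
Proof.
move=> s12 braid e1 e2 m E0 E1 E2.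
have := @linear_prod_eq _ _ iota h q h_quad h_comm (map f l1) (map f l2).
rewrite !size_map => /(_ s12 braid E0 E1 E2).
by rewrite !big_map.
Qed.

(* The arguments X^p Y^r below are the positive roots of the rank 2 root systems, in
   the order given by a reduced word of the longest element. *)
Lemma yang_baxter2 X Y : alt_prod h true 2 = alt_prod h false 2 ->
  \prod_(t <- [:: (true, X); (false, Y)]) yb_factor t =
  \prod_(t <- [:: (false, Y); (true, X)]) yb_factor t.
Proof.
move=> braid; apply: (@linear_map_prod_eq yb_coef [:: (true, X); (false, Y)]
  [:: (false, Y); (true, X)] erefl braid).
- rewrite /=; ring.
- by move=> b [|//] _; case: b; rewrite /=; ring.
- rewrite /=; ring.
Qed.

Definition root_coef (t : bool * B) := (t.1, (1 - t.2, - q t.1)).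

Lemma yang_baxter3 X Y : alt_prod h true 3 = alt_prod h false 3 ->
  q false = q true -> q' true = q true -> q' false = q true ->
  \prod_(t <- [:: (true, X); (false, X * Y); (true, Y)]) yb_factor t =
  \prod_(t <- [:: (false, Y); (true, X * Y); (false, X)]) yb_factor t.
Proof.
move=> braid q1 q2 q3; have q3' : q' false = q false by rewrite q1.
rewrite !(yb_prodE _ q2 q3'); congr (iota _ * _); first by rewrite !big_cons !big_nil /=; ring.
rewrite !big_map.
apply: (@linear_map_prod_eq root_coef [:: (true, X); (false, X * Y); (true, Y)]
  [:: (false, Y); (true, X * Y); (false, X)] erefl braid).
- rewrite /= q1; ring.
- by move=> b [|[|//]] _; case: b; rewrite /= q1; ring.
- rewrite /= q1; ring.
Qed.

(** The generator [false] may carry two different parameters q and q', as in type C, so that no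
    factor 1 + x is split off and the full quadratic coefficients are compared. *)
Lemma yang_baxter4 X Y : alt_prod h true 4 = alt_prod h false 4 -> q' true = q true ->
  \prod_(t <- [:: (true, X); (false, X * Y); (true, X * Y ^+ 2); (false, Y)]) yb_factor t =
  \prod_(t <- [:: (false, Y); (true, X * Y ^+ 2); (false, X * Y); (true, X)]) yb_factor t.
Proof.
move=> braid q1.
apply: (@linear_map_prod_eq yb_coef [:: (true, X); (false, X * Y); (true, X * Y ^+ 2); (false, Y)]
  [:: (false, Y); (true, X * Y ^+ 2); (false, X * Y); (true, X)] erefl braid).
- rewrite /= q1; ring.
- by move=> b [|[|[|//]]] _; case: b; rewrite /= q1; ring.
- rewrite /= q1; ring.
Qed.

Lemma yang_baxter6 X Y : alt_prod h true 6 = alt_prod h false 6 ->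
  q' true = q true -> q' false = q false ->
  \prod_(t <- [:: (true, X); (false, X * Y); (true, X ^+ 2 * Y ^+ 3); (false, X * Y ^+ 2);
                   (true, X * Y ^+ 3); (false, Y)]) yb_factor t =
  \prod_(t <- [:: (false, Y); (true, X * Y ^+ 3); (false, X * Y ^+ 2);
                   (true, X ^+ 2 * Y ^+ 3); (false, X * Y); (true, X)]) yb_factor t.
Proof.
move=> braid q1 q2; rewrite !(yb_prodE _ q1 q2).
congr (iota _ * _); first by rewrite !big_cons !big_nil /=; ring.
rewrite !big_map.
apply: (@linear_map_prod_eq root_coef [:: (true, X); (false, X * Y);
    (true, X ^+ 2 * Y ^+ 3); (false, X * Y ^+ 2); (true, X * Y ^+ 3); (false, Y)]
  [:: (false, Y); (true, X * Y ^+ 3); (false, X * Y ^+ 2);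
      (true, X ^+ 2 * Y ^+ 3); (false, X * Y); (true, X)] erefl braid).
- rewrite /=; ring.
- by move=> b [|[|[|[|[|//]]]]] _; case: b; rewrite /=; ring.
- rewrite /=; ring.
Qed.

End YangBaxter.

(** * Operators *)

Section EndomorphismRing.
Variable M : zmodType.

(** Maps are only additive, so that multiplication by a scalar and by Z^mu are on the same footing
    as elements of one ring; K-linearity becomes commutation with the scalars. *)
Record endo := Endo { endo_fun :> M -> M; endo_additive : additive endo_fun }.

HB.instance Definition _ := gen_eqMixin endo.
HB.instance Definition _ := gen_choiceMixin endo.
HB.instance Definition _ (f : endo) :=
  GRing.isZmodMorphism.Build M M f (endo_additive f).

Implicit Types f g h : endo.

Lemma endoP f g : f =1 g -> f = g.
Proof.
case: f g => [f fA] [g gA] /= /funext fg; move: gA; rewrite -fg => gA.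
by congr Endo; exact: Prop_irrelevance.
Qed.

Fact endo_add_additive f g : additive (fun x => f x + g x).
Proof. by move=> x y; rewrite !raddfB opprD addrACA. Qed.
Fact endo_opp_additive f : additive (fun x => - f x).
Proof. by move=> x y; rewrite raddfB opprD. Qed.
Fact endo_zero_additive : additive (fun _ : M => 0 : M).
Proof. by move=> x y; rewrite subr0. Qed.
Fact endo_one_additive : additive (fun x : M => x).
Proof. by []. Qed.
Fact endo_mul_additive f g : additive (fun x => f (g x)).
Proof. by move=> x y; rewrite !raddfB. Qed.

Definition endo_add f g := Endo (endo_add_additive f g).
Definition endo_opp f := Endo (endo_opp_additive f).
Definition endo_zero := Endo endo_zero_additive.
Definition endo_one := Endo endo_one_additive.
Definition endo_mul f g := Endo (endo_mul_additive f g).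

Fact endo_addA : associative endo_add.
Proof. by move=> f g h; apply: endoP => x; exact: addrA. Qed.
Fact endo_addC : commutative endo_add.
Proof. by move=> f g; apply: endoP => x; exact: addrC. Qed.
Fact endo_add0 : left_id endo_zero endo_add.
Proof. by move=> f; apply: endoP => x; exact: add0r. Qed.
Fact endo_addN : left_inverse endo_zero endo_opp endo_add.
Proof. by move=> f; apply: endoP => x; exact: addNr. Qed.

HB.instance Definition _ :=
  GRing.isZmodule.Build endo endo_addA endo_addC endo_add0 endo_addN.

Fact endo_mulA : associative endo_mul.
Proof. by move=> f g h; apply: endoP. Qed.
Fact endo_mul1l : left_id endo_one endo_mul.
Proof. by move=> f; apply: endoP. Qed.
Fact endo_mul1r : right_id endo_one endo_mul.
Proof. by move=> f; apply: endoP. Qed.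
Fact endo_mulDl : left_distributive endo_mul +%R.
Proof. by move=> f g h; apply: endoP. Qed.
Fact endo_mulDr : right_distributive endo_mul +%R.
Proof. by move=> f g h; apply: endoP => x; exact: raddfD. Qed.

HB.instance Definition _ := GRing.Zmodule_isPzRing.Build endo
  endo_mulA endo_mul1l endo_mul1r endo_mulDl endo_mulDr.

Lemma endoD f g x : (f + g) x = f x + g x. Proof. by []. Qed.
Lemma endo1 x : (1 : endo) x = x. Proof. by []. Qed.
Lemma endoM f g x : (f * g) x = f (g x). Proof. by []. Qed.
Lemma endo_sum (J : Type) (r : seq J) (P : pred J) (F : J -> endo) x :
  (\sum_(j <- r | P j) F j) x = \sum_(j <- r | P j) F j x.
Proof. by elim/big_rec2: _ => // j _ f _ <-. Qed.

Lemma endofD f x y : f (x + y) = f x + f y. Proof. exact: raddfD. Qed.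
Lemma endofB f x y : f (x - y) = f x - f y. Proof. exact: raddfB. Qed.
Lemma endofN f x : f (- x) = - f x. Proof. exact: raddfN. Qed.
Lemma endof0 f : f 0 = 0. Proof. exact: raddf0. Qed.

End EndomorphismRing.

(** * A commutative ring of operators standing for the coefficients *)

Section Bicommutant.
Variables (A : pzRingType) (S : A -> Prop).

Definition centralizes (x : A) := forall y, S y -> x * y = y * x.

(** These are the elements of S'' that lie in S'. The first clause puts each of them in S', and the
    second makes the others commute with it: the ring is commutative. It also commutes, by
    construction, with every operator that commutes with [S], in particular with those acting on the
    factor H_w only. *)
Definition bicommutant_pred : {pred A} :=
  fun b => `[< centralizes b /\ forall x, centralizes x -> b * x = x * b >].

Fact bicommutant_subring : subring_closed bicommutant_pred.
Proof.
split=> [|x y|x y].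
- by apply/asboolP; split=> [y|x] _; rewrite mul1r mulr1.
- move=> /asboolP[x1 x2] /asboolP[y1 y2]; apply/asboolP; split=> z zS.
    by rewrite mulrBl mulrBr x1 // y1.
  by rewrite mulrBl mulrBr x2 // y2.
- move=> /asboolP[x1 x2] /asboolP[y1 y2]; apply/asboolP; split=> z zS.
    by rewrite -mulrA y1 // mulrA x1 // mulrA.
  by rewrite -mulrA y2 // mulrA x2 // mulrA.
Qed.

HB.instance Definition _ :=
  GRing.isSubringClosed.Build A bicommutant_pred bicommutant_subring.

Record bicommutant : Type := Bicommutant { bicommutant_val : A;
                                    _ : bicommutant_val \in bicommutant_pred }.

HB.instance Definition _ := [isSub for bicommutant_val].
HB.instance Definition _ := [Choice of bicommutant by <:].
HB.instance Definition _ :=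
  GRing.SubChoice_isSubPzRing.Build A bicommutant_pred bicommutant (subringClosedP _).

Lemma bicommutant_comm (b : bicommutant) x :
  centralizes x -> val b * x = x * val b.
Proof. by have /asboolP[_] := valP b; apply. Qed.

Fact bicommutant_mulC : commutative (@GRing.mul bicommutant).
Proof.
move=> b c; apply: val_inj; rewrite !rmorphM /=; apply: bicommutant_comm.
by have /asboolP[] := valP c.
Qed.

HB.instance Definition _ :=
  GRing.PzRing_hasCommutativeMul.Build bicommutant bicommutant_mulC.

Lemma bicommutantP b : (forall x, centralizes x -> b * x = x * b) ->
  centralizes b -> b \in bicommutant_pred.
Proof. by move=> b1 b2; apply/asboolP. Qed.

End Bicommutant.

Section FreeModule.
Variables (K : comNzRingType) (T : choiceType).
Local Notation H := {freeg T / K}.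

Lemma freegZU (c : K) (x : T) : << c *g x >> = c *: << x >> :> H.
Proof. by apply/eqP/freeg_eqP => y; rewrite coeffZ !coeffU mul1r. Qed.

Lemma freeg_ext (M : zmodType) (f g : H -> M) : additive f -> additive g ->
  (forall c x, f (c *: << x >>) = g (c *: << x >>)) -> f =1 g.
Proof.
move=> fA gA fg D; rewrite -[D]freeg_sumE.
pose F : {additive H -> M} := HB.pack f (GRing.isZmodMorphism.Build _ _ f fA).
pose G : {additive H -> M} := HB.pack g (GRing.isZmodMorphism.Build _ _ g gA).
rewrite -[f]/(F : H -> M) -[g]/(G : H -> M) !raddf_sum; apply: eq_bigr => x _.
by rewrite freegZU; exact: fg.
Qed.

Definition lext (f : T -> H) : endo H := Endo (lift_is_additive f).

Lemma lextU f x : lext f << x >> = f x.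
Proof. by rewrite /= liftU scale1r. Qed.

Lemma lextZ f c D : lext f (c *: D) = c *: lext f D.
Proof.
apply: (@freeg_ext _ (fun D => lext f (c *: D)) (fun D => c *: lext f D)).
- by move=> x y; rewrite scalerBr raddfB.
- by move=> x y; rewrite raddfB scalerBr.
- by move=> d x; rewrite scalerA -!freegZU /= !liftU scalerA.
Qed.

Fact scal_additive (c : K) : additive (fun D : H => c *: D).
Proof. by move=> x y; exact: scalerBr. Qed.

Definition scal c : endo H := Endo (scal_additive c).

Lemma lext_scal f c : lext f * scal c = scal c * lext f.
Proof. by apply: endoP => D; exact: lextZ. Qed.

Lemma scal_comm_ext (f g : endo H) : (forall c, f * scal c = scal c * f) ->
  (forall c, g * scal c = scal c * g) -> (forall x, f << x >> = g << x >>) -> f = g.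
Proof.
move=> fc gc fg; apply: endoP; apply: freeg_ext; try exact: endo_additive.
move=> c x; rewrite -[f _]/((f * scal c) << x >>) -[g _]/((g * scal c) << x >>).
by rewrite fc gc !endoM fg.
Qed.

End FreeModule.

(* The locks keep unification from unfolding operators on distinct basis vectors. *)
HB.lock Definition base (R : realType) (V : vectType R) (I : finType)
  (D : root_datum V I) (K : comNzRingType) (y : lattice_type D) (w : weyl_type D) :
  {freeg (lattice_type D * weyl_type D) / K} := << (y, w) >>.

HB.lock Definition trans (R : realType) (V : vectType R) (I : finType)
  (D : root_datum V I) (K : comNzRingType) (mu : lattice_type D) :
  endo {freeg (lattice_type D * weyl_type D) / K} :=
  lext (fun x => base K (x.1 + mu) x.2).

HB.lock Definition twist (R : realType) (V : vectType R) (I : finType)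
  (D : root_datum V I) (K : comNzRingType) (u : weyl_type D) :
  endo {freeg (lattice_type D * weyl_type D) / K} :=
  lext (fun x => base K (weyl_act u x.1) x.2).

HB.lock Definition proj (R : realType) (V : vectType R) (I : finType)
  (D : root_datum V I) (K : comNzRingType) (w : weyl_type D) :
  endo {freeg (lattice_type D * weyl_type D) / K} :=
  lext (fun x => if x.2 == w then base K x.1 1%g else 0).

HB.lock Definition move_to (R : realType) (V : vectType R) (I : finType)
  (D : root_datum V I) (K : comNzRingType) (w : weyl_type D) :
  endo {freeg (lattice_type D * weyl_type D) / K} :=
  lext (fun x => base K x.1 w).

(** Left multiplication by H_i in the Hecke algebra of W with coefficients in R_1[Y]. Here Z^y is a
    central coefficient; this is not yet the operator T_i. *)
HB.lock Definition hecke_l (R : realType) (V : vectType R) (I : finType)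
  (D : root_datum V I) (K : comNzRingType) (q : I -> K) (i : I) :
  endo {freeg (lattice_type D * weyl_type D) / K} :=
  lext (fun x => base K x.1 (weyl_s D i * x.2)%g +
    (if (ell (weyl_s D i * x.2)%g < ell x.2)%N then q i *: base K x.1 x.2 else 0)).

HB.lock Definition hecke_r (R : realType) (V : vectType R) (I : finType)
  (D : root_datum V I) (K : comNzRingType) (q : I -> K) (i : I) :
  endo {freeg (lattice_type D * weyl_type D) / K} :=
  lext (fun x => base K x.1 (x.2 * weyl_s D i)%g +
    (if (ell (x.2 * weyl_s D i)%g < ell x.2)%N then q i *: base K x.1 x.2 else 0)).

(** * Left and right multiplications in the Hecke algebra of W *)

Section HeckeOperators.
Variables (R : realType) (V : vectType R) (I : finType) (D : root_datum V I).
Variables (K : comNzRingType) (q : I -> K).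

Local Notation W := (weyl_type D).
Local Notation Y := (lattice_type D).
Local Notation s := (weyl_s D).
Local Notation H := {freeg (Y * W) / K}.
Local Notation len w := (@ell R V I D w%g).
Implicit Types (i j k : I) (u v w : W) (y mu : Y).

Local Notation base := (@base R V I D K).
Local Notation trans := (@trans R V I D K).
Local Notation twist := (@twist R V I D K).
Local Notation proj := (@proj R V I D K).
Local Notation move_to := (@move_to R V I D K).
Local Notation hecke_l := (@hecke_l R V I D K q).
Local Notation hecke_r := (@hecke_r R V I D K q).

Lemma weyl_actM u v y : weyl_act (u * v)%g y = weyl_act u (weyl_act v y).
Proof. by apply: val_inj; rewrite /= comp_lfunE. Qed.

Lemma weyl_act1 y : weyl_act (1%g : W) y = y.
Proof. by apply: val_inj; rewrite /= id_lfunE. Qed.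

Fact weyl_act_additive u : additive (@weyl_act R V I D u).
Proof. by move=> x y; apply: val_inj; rewrite /= raddfB. Qed.

HB.instance Definition _ u :=
  GRing.isZmodMorphism.Build Y Y (@weyl_act R V I D u) (weyl_act_additive u).

Lemma transE mu y w : trans mu (base y w) = base (y + mu) w.
Proof. by rewrite trans.unlock base.unlock lextU. Qed.
Lemma twistE u y w : twist u (base y w) = base (weyl_act u y) w.
Proof. by rewrite twist.unlock base.unlock lextU. Qed.
Lemma projE v y w : proj v (base y w) = if w == v then base y 1%g else 0.
Proof. by rewrite proj.unlock base.unlock lextU. Qed.
Lemma move_toE v y w : move_to v (base y w) = base y v.
Proof. by rewrite move_to.unlock base.unlock lextU. Qed.
Lemma hecke_lE i y w : hecke_l i (base y w) = base y (s i * w)%g +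
  (if (len (s i * w) < len w)%N then q i *: base y w else 0).
Proof. by rewrite hecke_l.unlock base.unlock lextU. Qed.
Lemma hecke_rE i y w : hecke_r i (base y w) = base y (w * s i)%g +
  (if (len (w * s i) < len w)%N then q i *: base y w else 0).
Proof. by rewrite hecke_r.unlock base.unlock lextU. Qed.

Definition scalar_op (f : endo H) := (exists mu, f = trans mu) \/ (exists c, f = scal _ c).

Definition klin (f : endo H) := forall c, f * scal _ c = scal _ c * f.

Lemma klin_mul f g : klin f -> klin g -> klin (f * g).
Proof. by move=> fc gc c; rewrite -mulrA gc mulrA fc mulrA. Qed.

Lemma klin_add f g : klin f -> klin g -> klin (f + g).
Proof. by move=> fc gc c; rewrite mulrDl mulrDr fc gc. Qed.

Lemma klin1 : klin 1.
Proof. by move=> c; rewrite mul1r mulr1. Qed.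

Lemma klin_scal c : klin (scal _ c).
Proof. by move=> d; apply: endoP => x; rewrite !endoM /= !scalerA mulrC. Qed.

Lemma klinZ f c x : klin f -> f (c *: x) = c *: f x.
Proof. by move=> fc; rewrite -[LHS]/((f * scal _ c) x) fc. Qed.

Lemma klin_trans mu : klin (trans mu). Proof. rewrite trans.unlock; exact: lext_scal. Qed.
Lemma klin_twist u : klin (twist u). Proof. rewrite twist.unlock; exact: lext_scal. Qed.
Lemma klin_proj u : klin (proj u). Proof. rewrite proj.unlock; exact: lext_scal. Qed.
Lemma klin_hecke_l i : klin (hecke_l i). Proof. rewrite hecke_l.unlock; exact: lext_scal. Qed.
Lemma klin_hecke_r i : klin (hecke_r i). Proof. rewrite hecke_r.unlock; exact: lext_scal. Qed.
Lemma klin_move_to u : klin (move_to u). Proof. rewrite move_to.unlock; exact: lext_scal. Qed.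
Hint Resolve klin_mul klin_add klin1 klin_scal klin_trans klin_twist : core.
Hint Resolve klin_proj klin_move_to klin_hecke_l klin_hecke_r : core.

Lemma klin_ext (f g : endo H) : klin f -> klin g ->
  (forall y w, f (base y w) = g (base y w)) -> f = g.
Proof.
move=> fc gc fg; apply: scal_comm_ext => // -[y w].
by have := fg y w; rewrite base.unlock.
Qed.

Lemma transM mu nu : trans mu * trans nu = trans (mu + nu).
Proof.
apply: klin_ext => [||y w]; auto.
by rewrite endoM !transE -addrA [nu + mu]addrC.
Qed.

Lemma trans0 : trans 0 = 1.
Proof. by apply: klin_ext => [||y w]; auto; rewrite transE addr0. Qed.

Lemma twist_trans u mu : twist u * trans mu = trans (weyl_act u mu) * twist u.
Proof.
apply: klin_ext => [||y w]; auto.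
by rewrite !endoM transE !twistE transE raddfD.
Qed.

Lemma twistM u v : twist (u * v)%g = twist u * twist v.
Proof. by apply: klin_ext => [||y w]; auto; rewrite endoM !twistE weyl_actM. Qed.

Lemma twist1 : twist 1%g = 1.
Proof. by apply: klin_ext => [||y w]; auto; rewrite twistE weyl_act1. Qed.

Lemma twist_hecke_l u i : twist u * hecke_l i = hecke_l i * twist u.
Proof.
apply: klin_ext => [||y w]; auto; rewrite !endoM hecke_lE twistE hecke_lE endofD twistE.
by congr (_ + _); case: ifP => _; rewrite ?endof0 // klinZ ?twistE.
Qed.

Lemma centralizesP f : klin f -> (forall mu, f * trans mu = trans mu * f) ->
  centralizes scalar_op f.
Proof. by move=> fc ft _ [[mu ->]|[c ->]]. Qed.

Lemma centralizes_hecke_l i : centralizes scalar_op (hecke_l i).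
Proof.
apply: centralizesP => // mu; apply: klin_ext => [||y w]; auto.
rewrite !endoM hecke_lE transE hecke_lE endofD transE.
by congr (_ + _); case: ifP => _; rewrite ?endof0 // klinZ ?transE.
Qed.

Lemma centralizes_proj v : centralizes scalar_op (proj v).
Proof.
apply: centralizesP => // mu; apply: klin_ext => [||y w]; auto.
rewrite !endoM projE transE projE.
by case: ifP => _; rewrite ?endof0 // transE.
Qed.

Lemma centralizes_move_to w : centralizes scalar_op (move_to w).
Proof.
apply: centralizesP => // mu; apply: klin_ext => [||y v]; auto.
by rewrite !endoM transE !move_toE transE.
Qed.

Lemma centralizes_trans mu : centralizes scalar_op (trans mu).
Proof. by apply: centralizesP => // nu; rewrite !transM addrC. Qed.

Lemma centralizes_scal c : centralizes scalar_op (scal _ c).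
Proof. by apply: centralizesP => // nu; rewrite klin_trans. Qed.

Lemma hecke_l_quad i : hecke_l i * hecke_l i = scal _ (q i) * hecke_l i + 1.
Proof.
apply: klin_ext => [||y w]; auto; rewrite endoD endo1 !endoM hecke_lE endofD hecke_lE weyl_sK.
have := @ell_sl_neq _ _ _ D i w; case: ltngtP => [iw|iw|-> //] _.
  by rewrite endof0 !addr0 addrC.
by rewrite addr0 klinZ // hecke_lE iw addrC.
Qed.

Hypothesis q_conj : forall i j, i != j -> bond D i j = 3%N -> q i = q j.

(** Unless r_i w = w r_j, multiplying w on one side does not affect whether the reflection on the
    other side is a descent, and the terms match one by one. In the exceptional case r_i and r_j are
    conjugate, and q_i = q_j matches the remaining terms. *)
Lemma hecke_lr i j : hecke_l i * hecke_r j = hecke_r j * hecke_l i.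
Proof.
apply: klin_ext => [||y w]; auto.
rewrite !endoM hecke_lE hecke_rE !endofD hecke_lE hecke_rE -!addrA [(s i * (w * _))%g]mulgA.
congr (_ + _).
have -> : hecke_l i (if (len (w * s j) < len w)%N then q j *: base y w else 0) =
    (if (len (w * s j) < len w)%N then q j *: base y (s i * w)%g else 0) +
    (if (len (w * s j) < len w)%N && (len (s i * w) < len w)%N then (q j * q i) *: base y w else 0).
  case: ifP => _; last by rewrite endof0 add0r.
  by rewrite klinZ // hecke_lE scalerDr; case: ifP => _; rewrite /= ?scaler0 // scalerA.
have -> : hecke_r j (if (len (s i * w) < len w)%N then q i *: base y w else 0) =
    (if (len (s i * w) < len w)%N then q i *: base y (w * s j)%g else 0) +
    (if (len (w * s j) < len w)%N && (len (s i * w) < len w)%N then (q j * q i) *: base y w else 0).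
  case: ifP => _; last by rewrite endof0 add0r andbF.
  by rewrite klinZ // hecke_rE scalerDr; case: ifP => _; rewrite /= ?scaler0 // scalerA mulrC.
rewrite !addrA; congr (_ + _).
have [E|NE] := pselect (s i * w = w * s j)%g.
  have qij : q i = q j by apply: (conj_invariant q_conj E).
  by rewrite qij E.
by rewrite folding_descent_r // -mulgA folding_descent // addrC.
Qed.


Lemma hecke_r_ascent j y w : (len w < len (w * s j))%N ->
  hecke_r j (base y w) = base y (w * s j)%g.
Proof. by move=> lt; rewrite hecke_rE ltnNge ltnW //= addr0. Qed.

Lemma hecke_l_ascent j y w : (len w < len (s j * w))%N ->
  hecke_l j (base y w) = base y (s j * w)%g.
Proof. by move=> lt; rewrite hecke_lE ltnNge ltnW //= addr0. Qed.

(** Right multiplications along a reduced word reach every Z^y H_w from Z^y, so that an operator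
    commuting with them is determined by its values at the Z^y. *)
Lemma hecke_r_ext (f g : endo H) : klin f -> klin g ->
  (forall j, f * hecke_r j = hecke_r j * f) -> (forall j, g * hecke_r j = hecke_r j * g) ->
  (forall y, f (base y 1%g) = g (base y 1%g)) -> f = g.
Proof.
move=> fc gc fr gr fg; apply: klin_ext => // y w.
have [n] := ubnP (len w); elim: n w => // n IHn w wn.
have [->//|w1] := pselect (w = 1%g).
have [|k kw] := @weyl_left_descent _ _ _ D (w^-1)%g.
  by move=> E; apply: w1; apply: invg_inj; rewrite E invg1.
rewrite ellV -ell_sr in kw.
have wE : hecke_r k (base y (w * s k)%g) = base y w.
  by rewrite hecke_r_ascent weyl_sKr.
rewrite -wE -!endoM fr gr !endoM IHn //; exact: leq_trans kw _.
Qed.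

Lemma ell_alt_bond i j n : i != j -> (bond D i j = 0 \/ n <= bond D i j)%N ->
  len (alt D i j n) = n.
Proof.
elim: n i j => [|n IHn] i j ij nb; first exact: ell1.
have nb' : (bond D j i = 0 \/ n <= bond D j i)%N.
  by rewrite bond_sym; case: nb => [|/ltnW]; auto.
have {}IHn : len (alt D j i n) = n by apply: IHn => //; rewrite eq_sym.
have : (len (alt D j i n) < len (s i * alt D j i n))%N.
  apply/nonneg_root_form_iff.
  have [p [p' [p0 p0']]] := root_form_alt 1%g ij nb.
  rewrite mulg1 /root_form !comp_lfun1r => ->.
  by apply: nonneg_formD; apply: nonneg_formZ => //; exact: nonneg_form_root.
rewrite -altS IHn => lt; apply/eqP; rewrite eqn_leq lt andbT -{2}IHn altS.
exact: ell_sl.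
Qed.

Lemma hecke_l_word y l : size l = len (weyl_prod D l) ->
  (\prod_(k <- l) hecke_l k) (base y 1%g) = base y (weyl_prod D l).
Proof.
elim: l => [|i l IHl] /= ll; first by rewrite big_nil.
have E : size l = len (weyl_prod D l).
  by apply/eqP; rewrite eqn_leq ell_prod andbT -ltnS ll ell_sl.
by rewrite big_cons endoM IHl // hecke_l_ascent // -E -ll.
Qed.

Lemma klin_prod (J : Type) (r : seq J) (F : J -> endo H) :
  (forall m, klin (F m)) -> klin (\prod_(m <- r) F m).
Proof. by move=> FK; elim/big_ind: _ => //; auto. Qed.

Lemma hecke_lr_word l j :
  (\prod_(k <- l) hecke_l k) * hecke_r j = hecke_r j * (\prod_(k <- l) hecke_l k).
Proof.
elim: l => [|i l IHl]; first by rewrite big_nil mul1r mulr1.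
by rewrite big_cons -mulrA IHl !mulrA hecke_lr.
Qed.

(** Both sides commute with the right multiplications and send Z^y to Z^y H_w for the same w, the
    two alternating words being reduced. *)
Lemma hecke_l_braid i j : i != j ->
  \prod_(k <- alt_seq i j (bond D i j)) hecke_l k =
  \prod_(k <- alt_seq j i (bond D i j)) hecke_l k.
Proof.
move=> ij; have ji : j != i by rewrite eq_sym.
apply: hecke_r_ext => [||k|k|y]; try exact: hecke_lr_word; try exact: klin_prod.
rewrite !hecke_l_word ?weyl_prod_alt ?size_alt_seq ?ell_alt_bond //;
  try by right; rewrite // bond_sym.
by rewrite (alt_bond D ij).
Qed.

End HeckeOperators.

(** * Intertwiners *)

Section Intertwiners.
Variables (R : realType) (V : vectType R) (I : finType) (D : root_datum V I).
Variables (K : comNzRingType) (q q' : I -> K).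
Hypothesis q_conj : forall i j, i != j -> bond D i j = 3%N -> q i = q j.
Hypothesis q_odd : forall i (y : lattice_type D), odd `|pairing i y|%N -> q' i = q i.

Local Notation W := (weyl_type D).
Local Notation Y := (lattice_type D).
Local Notation s := (weyl_s D).
Local Notation H := {freeg (Y * W) / K}.
Local Notation B := (bicommutant (@scalar_op R V I D K)).
Local Notation hl := (hecke_l D q).
Local Notation c := (coroot D).
Implicit Types (i j k : I) (u v w : W) (y mu : Y) (b : bool).

(* The bicommutant of the translations and scalars plays the role of R_1[Y]. *)
Fact trans_bicommutant mu : trans K mu \in bicommutant_pred (@scalar_op R V I D K).
Proof.
apply: bicommutantP; last exact: centralizes_trans.
by move=> x xS; rewrite xS //; left; exists mu.
Qed.

Fact scal_bicommutant (z : K) :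
  scal _ z \in bicommutant_pred (@scalar_op R V I D K).
Proof.
apply: bicommutantP; last exact: centralizes_scal.
by move=> x xS; rewrite xS //; right; exists z.
Qed.

Definition transB mu : B := Bicommutant (trans_bicommutant mu).
Definition scalB z : B := Bicommutant (scal_bicommutant z).

Lemma transBM mu nu : transB mu * transB nu = transB (mu + nu).
Proof. by apply: val_inj; rewrite rmorphM /= transM. Qed.

Lemma transB0 : transB 0 = 1.
Proof. by apply: val_inj; rewrite rmorph1 /= trans0. Qed.

Lemma transBX mu n : transB mu ^+ n = transB (mu *+ n).
Proof. by elim: n => [|n IHn]; rewrite ?transB0 // exprS IHn transBM mulrS. Qed.

Lemma hl_comm i (x : B) : hl i * val x = val x * hl i.
Proof. by rewrite bicommutant_comm //; exact: centralizes_hecke_l. Qed.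

Definition gfac i (x : B) : endo H :=
  val (1 - x ^+ 2) * hl i + val (- (scalB (q i) + scalB (q' i) * x)).

Definition tau i : endo H := gfac i (transB (- c i)) * twist K (s i).

Lemma gfac_trans i mu : gfac i (transB mu) =
  hl i - trans K (mu + mu) * hl i - (scal _ (q i) + scal _ (q' i) * trans K mu).
Proof.
rewrite /gfac expr2 transBM rmorphB rmorph1 rmorphN rmorphD rmorphM /=.
by rewrite mulrBl mul1r.
Qed.

Lemma twist_gfac u i mu :
  twist K u * gfac i (transB mu) = gfac i (transB (weyl_act u mu)) * twist K u.
Proof.
rewrite !gfac_trans !mulrBr !mulrBl mulrDr mulrDl !mulrA twist_trans twist_hecke_l.
rewrite !klin_twist -[_ * twist K u * hl i]mulrA twist_hecke_l -[_ * twist K u * trans K mu]mulrA.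
by rewrite twist_trans raddfD !mulrA.
Qed.

(** What is left of a product of [tau] once all twists are moved to its right end. The factor of the
    letter i then has the parameter Z^(-u c_i), u being the prefix before it: along the alternating
    words these are the arguments of the Yang-Baxter equations. *)
Fixpoint gword u (l : seq I) : endo H :=
  if l is i :: l' then gfac i (transB (- weyl_act u (c i))) * gword (u * s i)%g l' else 1.

Lemma tau_word u l :
  twist K u * \prod_(k <- l) tau k = gword u l * twist K (u * weyl_prod D l)%g.
Proof.
elim: l u => [|i l IHl] u /=; first by rewrite big_nil mulr1 mul1r mulg1.
rewrite big_cons mulrA /tau mulrA twist_gfac raddfN -!mulrA; congr (_ * _).
by rewrite mulrA -twistM IHl mulgA.
Qed.

Lemma pairing_coroot i j (p : int) : cartan D i j = p%:~R -> pairing i (c j) = - p.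
Proof.
move=> E; apply/eqP; rewrite -(eqr_int R) -pairingE rmorphN /= -E /cartan opprK.
exact: eqxx.
Qed.

Lemma pairing_coroot_self i : pairing i (c i) = 2.
Proof.
have a2 : simple_root D i (simple_coroot D i) = 2 by case: (cartanP D).
by apply/eqP; rewrite -(eqr_int R) -pairingE; apply/eqP.
Qed.

Lemma weyl_act_coroot i j (p x y : int) : cartan D i j = p%:~R ->
  weyl_act (s i) (c i *~ x + c j *~ y) = c i *~ (p * y - x) + c j *~ y.
Proof.
move=> E; rewrite raddfD !raddfMz /= !weyl_act_s pairing_coroot_self (pairing_coroot E).
rewrite -[X in (X - _) *~ x]mulr1z -mulrzBr -mulrzA mulrzBl -mulrzA addrCA [RHS]addrC.
by congr (_ + _); rewrite -mulrzBr; congr (_ *~ _); ring.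
Qed.

Lemma transB_comb i j (p r : nat) :
  transB (- c i) ^+ p * transB (- c j) ^+ r = transB (- (c i *~ p%:Z + c j *~ r%:Z)).
Proof. by rewrite !transBX transBM !mulNrn opprD -!pmulrn. Qed.

Lemma alt_prod_seq i j b n :
  alt_prod (fun b => hl (if b then i else j)) b n =
  \prod_(k <- if b then alt_seq i j n else alt_seq j i n) hl k.
Proof.
elim: n b => [|n IHn] [] /=; rewrite ?big_nil // big_cons IHn //.
Qed.

Section Rank2.
Variables (i j : I) (n m : int).
Hypotheses (ij : i != j) (cij : cartan D i j = n%:~R) (cji : cartan D j i = m%:~R).

Let sel b := if b then i else j.

Lemma alt_prod_braid : alt_prod (fun b => hl (sel b)) true (bond D i j) =
  alt_prod (fun b => hl (sel b)) false (bond D i j).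
Proof. by rewrite !alt_prod_seq; exact: hecke_l_braid. Qed.

Lemma hl_sel_quad b : hl (sel b) * hl (sel b) = val (scalB (q (sel b))) * hl (sel b) + 1.
Proof. exact: hecke_l_quad. Qed.

Lemma hl_sel_comm b (x : B) : hl (sel b) * val x = val x * hl (sel b).
Proof. exact: hl_comm. Qed.

Let ybf := yb_factor (val : {rmorphism B -> endo H}) (fun b => hl (sel b))
  (fun b => scalB (q (sel b))) (fun b => scalB (q' (sel b))).

Lemma yb_gfac (t : bool * B) : ybf t = gfac (sel t.1) t.2.
Proof. by []. Qed.

Lemma weyl_act_rank2 :
  (forall x y : int, weyl_act (s i) (c i *~ x + c j *~ y) = c i *~ (n * y - x) + c j *~ y) *
  (forall x y : int, weyl_act (s j) (c i *~ x + c j *~ y) = c i *~ x + c j *~ (m * x - y)).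
Proof.
split=> x y; first exact: weyl_act_coroot.
by rewrite addrC (weyl_act_coroot _ _ cji) addrC.
Qed.

Lemma weyl_act_rank2_simple : (weyl_act (s i) (c j) = c i *~ n + c j *~ 1) *
  (weyl_act (s j) (c i) = c i *~ 1 + c j *~ m).
Proof.
split; rewrite -[X in weyl_act _ X]addr0.
  by rewrite -[X in weyl_act _ (X + _)]mulr1z -(mulr0z (c i)) addrC weyl_act_rank2 mulr1 subr0.
by rewrite -[X in weyl_act _ (X + _)]mulr1z -(mulr0z (c j)) weyl_act_rank2 mulr1 subr0.
Qed.

Let X := transB (- c i).
Let Z := transB (- c j).

Lemma transB_comb10 : X = transB (- (c i *~ 1%:Z + c j *~ 0%:Z)).
Proof. by rewrite -transB_comb expr1 mulr1. Qed.

Lemma transB_comb01 : Z = transB (- (c i *~ 0%:Z + c j *~ 1%:Z)).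
Proof. by rewrite -transB_comb expr1 mul1r. Qed.

Lemma gword2 : bond D i j = 2%N -> n = 0 -> m = 0 ->
  gword 1%g (alt_seq i j 2) = gword 1%g (alt_seq j i 2).
Proof.
move=> b2 n0 m0; have braid := alt_prod_braid; rewrite b2 in braid.
have := yang_baxter2 (fun b => scalB (q' (sel b))) hl_sel_quad hl_sel_comm X Z braid.
rewrite !big_cons !big_nil -!/(ybf _) !yb_gfac.
rewrite /= !mul1g !weyl_act1 !weyl_act_rank2_simple n0 m0.
by rewrite !mulr0z !mulr1z addr0 add0r.
Qed.

Lemma gword3 : bond D i j = 3%N -> n = 1 -> m = 1 ->
  gword 1%g (alt_seq i j 3) = gword 1%g (alt_seq j i 3).
Proof.
move=> b3 n0 m0; have braid := alt_prod_braid; rewrite b3 in braid.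
have q1 : scalB (q (sel false)) = scalB (q (sel true)) by rewrite /= (q_conj ij).
have := @yang_baxter3 _ _ _ _ _ (fun b => scalB (q' (sel b))) hl_sel_quad hl_sel_comm X Z braid q1.
rewrite !big_cons !big_nil -!/(ybf _) !yb_gfac.
rewrite /= !mul1g !weyl_actM !weyl_act1 !weyl_act_rank2_simple !weyl_act_rank2 n0 m0.
have q2 : q' i = q i by apply: (@q_odd i (c j)); rewrite (pairing_coroot cij) n0.
have q3 : q' j = q j by apply: (@q_odd j (c i)); rewrite (pairing_coroot cji) m0.
rewrite /= q2 q3 -(q_conj ij b3) => /(_ erefl erefl).
have -> : X * Z = transB (- (c i *~ 1%:Z + c j *~ 1%:Z)) by rewrite -transB_comb !expr1.
rewrite -/X -/Z [X]transB_comb10 [Z]transB_comb01 => E.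
exact: E.
Qed.

(** Here alpha_i(c_j) = -1 is odd and gives q'_i = q_i, while alpha_j(c_i) = -2 says nothing about
    q'_j; this is the asymmetry in [yang_baxter4]. *)
Lemma gword4 : bond D i j = 4%N -> n = 1 -> m = 2 ->
  gword 1%g (alt_seq i j 4) = gword 1%g (alt_seq j i 4).
Proof.
move=> b4 n0 m0; have braid := alt_prod_braid; rewrite b4 in braid.
have q2 : q' i = q i by apply: (@q_odd i (c j)); rewrite (pairing_coroot cij) n0.
have q1 : scalB (q' (sel true)) = scalB (q (sel true)) by rewrite /= q2.
have := @yang_baxter4 _ _ _ _ _ (fun b => scalB (q' (sel b))) hl_sel_quad hl_sel_comm X Z braid q1.
rewrite !big_cons !big_nil -!/(ybf _) !yb_gfac.
rewrite /= !mul1g !weyl_actM !weyl_act1 !weyl_act_rank2_simple !weyl_act_rank2 n0 m0.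
have -> : X * Z = transB (- (c i *~ 1%:Z + c j *~ 1%:Z)) by rewrite -transB_comb !expr1.
have -> : X * Z ^+ 2 = transB (- (c i *~ 1%:Z + c j *~ 2%:Z)) by rewrite -transB_comb !expr1.
rewrite -/X -/Z [X]transB_comb10 [Z]transB_comb01 => E.
exact: E.
Qed.

Lemma gword6 : bond D i j = 6%N -> n = 1 -> m = 3 ->
  gword 1%g (alt_seq i j 6) = gword 1%g (alt_seq j i 6).
Proof.
move=> b6 n0 m0; have braid := alt_prod_braid; rewrite b6 in braid.
have q2 : q' i = q i by apply: (@q_odd i (c j)); rewrite (pairing_coroot cij) n0.
have q3 : q' j = q j by apply: (@q_odd j (c i)); rewrite (pairing_coroot cji) m0.
have q2' : scalB (q' (sel true)) = scalB (q (sel true)) by rewrite /= q2.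
have q3' : scalB (q' (sel false)) = scalB (q (sel false)) by rewrite /= q3.
have := @yang_baxter6 _ _ _ _ _ (fun b => scalB (q' (sel b))) hl_sel_quad hl_sel_comm
  X Z braid q2' q3'.
rewrite !big_cons !big_nil -!/(ybf _) !yb_gfac.
rewrite /= !mul1g !weyl_actM !weyl_act1 !weyl_act_rank2_simple !weyl_act_rank2 n0 m0.
have -> : X * Z = transB (- (c i *~ 1%:Z + c j *~ 1%:Z)) by rewrite -transB_comb !expr1.
have -> : X * Z ^+ 2 = transB (- (c i *~ 1%:Z + c j *~ 2%:Z)) by rewrite -transB_comb !expr1.
have -> : X * Z ^+ 3 = transB (- (c i *~ 1%:Z + c j *~ 3%:Z)) by rewrite -transB_comb !expr1.
rewrite (transB_comb i j 2 3).
rewrite -/X -/Z [X]transB_comb10 [Z]transB_comb01 => E.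
exact: E.
Qed.

End Rank2.

Lemma gword_braid i j : i != j -> (1 < bond D i j)%N ->
  gword 1%g (alt_seq i j (bond D i j)) = gword 1%g (alt_seq j i (bond D i j)).
Proof.
have cartan_int k k' : k != k' -> exists p : int, cartan D k k' = p%:~R.
  by move=> /(cartan_nat D)[p ->]; exists p.
move=> ij b1; have ji : j != i by rewrite eq_sym.
have [n cij] := cartan_int _ _ ij; have [m cji] := cartan_int _ _ ji.
have intE (x y : int) : x%:~R = y%:~R :> R -> x = y by move=> /eqP; rewrite eqr_int => /eqP.
have cases (x y : R) (b : nat) : bond_spec x y b -> (1 < b)%N ->
    [\/ [/\ b = 2%N, x = 0%:~R & y = 0%:~R], [/\ b = 3%N, x = 1%:~R & y = 1%:~R],
        [/\ b = 4%N, x = 1%:~R & y = 2%:~R] \/ [/\ b = 4%N, x = 2%:~R & y = 1%:~R]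
      | [/\ b = 6%N, x = 1%:~R & y = 3%:~R] \/ [/\ b = 6%N, x = 3%:~R & y = 1%:~R]] :> Prop.
  by case=> // _; [apply: Or41 | apply: Or42 | apply: Or43; left | apply: Or43; right
    | apply: Or44; left | apply: Or44; right].
have spec := bondP D ij; rewrite cij cji in spec.
have bE : bond D j i = bond D i j by exact: bond_sym.
case: (cases _ _ _ spec b1) => [[b n0 m0]|[b n0 m0]|[[b n0 m0]|[b n0 m0]]|[[b n0 m0]|[b n0 m0]]];
  rewrite b in bE *.
- exact: (gword2 ij cij cji b (intE _ _ n0) (intE _ _ m0)).
- exact: (gword3 ij cij cji b (intE _ _ n0) (intE _ _ m0)).
- exact: (gword4 ij cij cji b (intE _ _ n0) (intE _ _ m0)).
- by symmetry; exact: (gword4 ji cji cij bE (intE _ _ m0) (intE _ _ n0)).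
- exact: (gword6 ij cij cji b (intE _ _ n0) (intE _ _ m0)).
- by symmetry; exact: (gword6 ji cji cij bE (intE _ _ m0) (intE _ _ n0)).
Qed.

Lemma tau_braid i j : i != j -> (1 < bond D i j)%N ->
  \prod_(k <- alt_seq i j (bond D i j)) tau k = \prod_(k <- alt_seq j i (bond D i j)) tau k.
Proof.
have tauE l : \prod_(k <- l) tau k = gword 1%g l * twist K (weyl_prod D l).
  by have := tau_word 1%g l; rewrite twist1 mul1r mul1g.
move=> ij b1; rewrite !tauE gword_braid //.
by rewrite !weyl_prod_alt (alt_bond D ij).
Qed.

End Intertwiners.

(** * Nonzerodivisors of R_1[Y] and the square of an intertwiner *)

Section Fractions.
Variables (R : realType) (V : vectType R) (I : finType) (D : root_datum V I).
Variables (K : comNzRingType) (q q' : I -> K).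
Hypothesis q_conj : forall i j, i != j -> bond D i j = 3%N -> q i = q j.
Hypothesis q_odd : forall i (y : lattice_type D), odd `|pairing i y|%N -> q' i = q i.

Local Notation W := (weyl_type D).
Local Notation Y := (lattice_type D).
Local Notation s := (weyl_s D).
Local Notation H := {freeg (Y * W) / K}.
Local Notation B := (bicommutant (@scalar_op R V I D K)).
Local Notation hl := (hecke_l D q).
Local Notation c := (coroot D).
Local Notation base := (@base R V I D K).
Local Notation klin := (@klin R V I D K).
Local Notation trans := (@trans R V I D K).
Local Notation twist := (@twist R V I D K).
Local Notation transB := (@transB R V I D K).
Local Notation scalB := (@scalB R V I D K).
Local Notation gfac := (@gfac R V I D K q q').
Local Notation tau := (@tau R V I D K q q').
Implicit Types (i j k : I) (u v w : W) (y mu : Y) (b : B).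

Lemma val_B_comm b (x : endo H) : centralizes (@scalar_op R V I D K) x ->
  val b * x = x * val b.
Proof. exact: bicommutant_comm. Qed.

Lemma klin_B b : klin (val b).
Proof. by move=> z; apply: bicommutant_comm; exact: centralizes_scal. Qed.

Lemma trans_B_comm b mu : val b * trans mu = trans mu * val b.
Proof. by apply: bicommutant_comm; exact: centralizes_trans. Qed.

Lemma twistK u : twist u^-1%g * twist u = 1.
Proof. by rewrite -twistM mulVg twist1. Qed.

Lemma twistVK u : twist u * twist u^-1%g = 1.
Proof. by rewrite -twistM mulgV twist1. Qed.

Lemma twist_centralizes u (x : endo H) : centralizes (@scalar_op R V I D K) x ->
  centralizes (@scalar_op R V I D K) (twist u * x * twist u^-1%g).
Proof.
move=> xS; apply: centralizesP => [|mu].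
  apply: klin_mul; last exact: klin_twist.
  apply: klin_mul; first exact: klin_twist.
  by move=> z; apply: xS; right; exists z.
have xt : x * trans (weyl_act u^-1%g mu) = trans (weyl_act u^-1%g mu) * x.
  by apply: xS; left; eexists.
rewrite -mulrA twist_trans -mulrA (mulrA x) xt !mulrA twist_trans.
by rewrite -weyl_actM mulgV weyl_act1.
Qed.

Fact conj_bicommutant u b :
  twist u * val b * twist u^-1%g \in bicommutant_pred (@scalar_op R V I D K).
Proof.
have bS : centralizes (@scalar_op R V I D K) (val b) by have /asboolP[] := valP b.
apply: bicommutantP; last exact: twist_centralizes.
move=> x xS; have := val_B_comm b (twist_centralizes u^-1%g xS); rewrite invgK => E.
have : twist u * (val b * (twist u^-1%g * x * twist u)) * twist u^-1%g =
   twist u * (twist u^-1%g * x * twist u * val b) * twist u^-1%g by rewrite E.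
rewrite !mulrA -[_ * twist u * twist _]mulrA twistVK mulr1 => ->.
by rewrite mul1r.
Qed.

Definition conjB u b : B := Bicommutant (conj_bicommutant u b).

Lemma twist_B u b : twist u * val b = val (conjB u b) * twist u.
Proof. by rewrite /= -[RHS]mulrA twistK mulr1. Qed.

Definition regular b := forall x, val b x = 0 -> x = 0.

Lemma regular1 : regular 1.
Proof. by move=> x; rewrite rmorph1. Qed.

Lemma regularM b1 b2 : regular b1 -> regular b2 -> regular (b1 * b2).
Proof. by move=> r1 r2 x; rewrite rmorphM endoM => /r1/r2. Qed.

Lemma regular_conjB u b : regular b -> regular (conjB u b).
Proof.
move=> br x; rewrite -[LHS]/(twist u (val b (twist u^-1%g x))).
move=> /(congr1 (twist u^-1%g)); rewrite endof0 -endoM twistK => /br.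
by move=> /(congr1 (twist u)); rewrite endof0 -endoM twistVK.
Qed.

Lemma lattice_torsion_free mu n : mu *+ n = 0 -> mu != 0 -> n = 0%N.
Proof.
move=> /(congr1 val); rewrite raddfMn /= -scaler_nat => /eqP.
rewrite scaler_eq0 pnatr_eq0 => /orP[/eqP //|/eqP m0] /eqP[].
exact: val_inj.
Qed.

Lemma coeff_trans mu y w (x : H) : coeff (y, w) (trans mu x) = coeff (y - mu, w) x.
Proof.
move: x; apply: freeg_ext => [x z|x z|z [y' w']]; rewrite ?endofB ?coeffB //.
rewrite klinZ; last exact: klin_trans.
have -> : trans mu << (y', w') >> = << (y' + mu, w') >>.
  by have := transE K mu y' w'; rewrite base.unlock.
rewrite !coeffZ !coeffU !mul1r; congr (_ * (_ : bool)%:R).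
by rewrite !xpair_eqE -subr_eq opprK.
Qed.

(** If Z^mu x = x, the coefficients of x are constant along y, y - mu, y - 2 mu, and so on. These
    points are distinct since the lattice has no torsion, whereas the support of x is finite. *)
Lemma regular_trans mu : mu != 0 -> regular (1 - transB mu).
Proof.
move=> mu0 x; rewrite rmorphB rmorph1 => /eqP; rewrite subr_eq0 => /eqP E.
have E0 : x = trans mu x by rewrite -[LHS]endo1 E.
have {E}E y w n : coeff (y, w) x = coeff (y - mu *+ n, w) x.
  elim: n => [|n ->]; first by rewrite subr0.
  by rewrite {1}E0 coeff_trans mulrSr opprD addrA.
apply/eqP/freeg_eqP => -[y w]; rewrite coeff0; apply/eqP; apply: contraT => xyw.
pose l := [seq (y - mu *+ n, w) | n <- iota 0 (size (dom x)).+1].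
suff : (size l <= size (dom x))%N by rewrite size_map size_iota ltnn.
apply: uniq_leq_size => [|z /mapP[n _ ->]]; last by rewrite mem_dom -E.
rewrite map_inj_uniq ?iota_uniq // => n1 n2 /(congr1 fst) E1.
have {}E1 : mu *+ n1 = mu *+ n2 by apply/oppr_inj/(addrI y).
wlog n12 : n1 n2 E1 / (n1 <= n2)%N.
  by move=> W; case: (leqP n1 n2) => [|/ltnW] n12; [exact: W | symmetry; exact: W].
have /lattice_torsion_free : mu *+ (n2 - n1) = 0 by rewrite mulrnBr // E1 subrr.
by move=> /(_ mu0)/eqP; rewrite subn_eq0 => n21; apply/eqP; rewrite eqn_leq n12.
Qed.

Lemma coroot_neq0 i : c i != 0.
Proof.
apply/eqP => /(congr1 (pairing i)); rewrite pairing_coroot_self.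
move=> /(congr1 (fun z : int => z%:~R : R)); rewrite -pairingE /= linear0 => /eqP.
by rewrite pnatr_eq0.
Qed.

Lemma regular_coroot i : regular (1 - transB (- c i) ^+ 2).
Proof.
rewrite transBX; apply: regular_trans; apply: contraNneq (coroot_neq0 i).
move=> /(congr1 -%R); rewrite -mulNrn opprK oppr0 => E.
by apply: contraT => /(lattice_torsion_free E).
Qed.

Lemma gfac_B i x b : gfac i x * val b = val b * gfac i x.
Proof.
rewrite /gfac mulrDl mulrDr -[_ * hl i * _]mulrA hl_comm !mulrA -!rmorphM.
by rewrite [_ * b]mulrC [- _ * b]mulrC.
Qed.

Lemma tau_B i b : tau i * val b = val (conjB (s i) b) * tau i.
Proof. by rewrite /tau -[LHS]mulrA twist_B [LHS]mulrA gfac_B -[LHS]mulrA. Qed.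

Definition tau_sq i : B := let x := transB (- c i) in let x' := transB (c i) in
  (1 - x ^+ 2) * (1 - x' ^+ 2) +
  (scalB (q i) + scalB (q' i) * x) * (scalB (q i) + scalB (q' i) * x').

Lemma linear_mul i (x y x' y' : B) :
  (val x * hl i + val y) * (val x' * hl i + val y') =
  val (x * x' * scalB (q i) + x * y' + y * x') * hl i + val (x * x' + y * y').
Proof.
have hx (z t : B) : val z * hl i * val t = val (z * t) * hl i.
  by rewrite -mulrA hl_comm mulrA rmorphM.
rewrite mulrDl !mulrDr hx mulrA hx -mulrA hecke_l_quad.
rewrite -[scal _ _]/(val (scalB (q i))) mulrDr mulr1 !mulrA -!rmorphM.
rewrite !rmorphD !mulrDl !addrA; congr (_ + _).
by rewrite -[LHS]addrA [LHS]addrAC -!addrA; congr (_ + _); rewrite addrCA addrA addrC -addrA.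
Qed.

(** Carrying one twist across the other factor replaces x = Z^(-c_i) by x' = Z^(c_i), and the twists
    cancel. The coefficient of [hl i] that remains is a multiple of x x' - 1, hence zero. *)
Lemma tau_tau i : tau i * tau i = val (tau_sq i).
Proof.
have sc : weyl_act (s i) (- c i) = c i.
  by rewrite raddfN /= weyl_act_s pairing_coroot_self opprB addrK.
rewrite /tau -[LHS]mulrA (mulrA (twist _)) twist_gfac sc -!mulrA -twistM weyl_ss twist1 mulr1.
have xx : transB (- c i) * transB (c i) = 1 by rewrite transBM addNr transB0.
rewrite /tau_sq /gfac linear_mul; move: (transB (- c i)) (transB (c i)) xx => x x' xx.
set z := scalB (q i); set z' := scalB (q' i).
have -> : (1 - x ^+ 2) * (1 - x' ^+ 2) * z + (1 - x ^+ 2) * - (z + z' * x') +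
    - (z + z' * x) * (1 - x' ^+ 2) = 0.
  transitivity (z * ((x * x') ^+ 2 - 1) + z' * (x + x') * (x * x' - 1)); first by ring.
  by rewrite xx expr1n !subrr !mulr0 addr0.
by rewrite rmorph0 mul0r add0r; congr val; rewrite mulrNN.
Qed.

End Fractions.

(** The operator T_i: condition (4) gives H_i Z^y H_w = Z^(r_i y) H_i H_w + b_i(y) H_w. As b_i(y)
    lies in R_1[Y], [move_to] is its right multiplication by H_w. *)
HB.lock Definition demazure (R : realType) (V : vectType R) (I : finType)
  (D : root_datum V I) (K : comNzRingType) (q : I -> K)
  (bern : I -> lattice_type D -> {freeg (lattice_type D * weyl_type D) / K}) (i : I) :
  endo {freeg (lattice_type D * weyl_type D) / K} :=
  lext (fun x => hecke_l D q i (base K (weyl_act (weyl_s D i) x.1) x.2) +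
                 move_to K x.2 (bern i x.1)).

(** * Fractions in the intertwiners and their triangularity *)

Section DemazureLusztig.
Variables (R : realType) (V : vectType R) (I : finType) (D : root_datum V I).
Variables (K : comNzRingType) (q q' : I -> K).
Hypothesis q_conj : forall i j, i != j -> bond D i j = 3%N -> q i = q j.
Hypothesis q_odd : forall i (y : lattice_type D), odd `|pairing i y|%N -> q' i = q i.

Local Notation W := (weyl_type D).
Local Notation Y := (lattice_type D).
Local Notation s := (weyl_s D).
Local Notation H := {freeg (Y * W) / K}.
Local Notation len w := (@ell R V I D w%g).
Local Notation B := (bicommutant (@scalar_op R V I D K)).
Local Notation hl := (hecke_l D q).
Local Notation c := (coroot D).
Local Notation base := (@base R V I D K).
Local Notation klin := (@klin R V I D K).
Local Notation trans := (@trans R V I D K).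
Local Notation twist := (@twist R V I D K).
Local Notation proj := (@proj R V I D K).
Local Notation move_to := (@move_to R V I D K).
Local Notation transB := (@transB R V I D K).
Local Notation scalB := (@scalB R V I D K).
Local Notation gfac := (@gfac R V I D K q q').
Local Notation tau := (@tau R V I D K q q').
Implicit Types (i j k : I) (u v w : W) (y mu : Y) (b : B).

(** The right-hand side of (4) enters through its equation with cleared denominator, which
    determines it because 1 - Z^(-2 c_i) is regular. *)
Variable bern : I -> Y -> H.
Hypothesis bern_supp : forall i y, move_to 1%g (bern i y) = bern i y.
Hypothesis bernE : forall i y, let x := base y 1%g - base (weyl_act (s i) y) 1%g in
  bern i y - trans (- (c i *+ 2)) (bern i y) = q i *: x + q' i *: trans (- c i) x.

Local Notation demazure := (@demazure R V I D K q bern).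

Lemma demazureE i y w :
  demazure i (base y w) = hl i (base (weyl_act (s i) y) w) + move_to w (bern i y).
Proof. by rewrite demazure.unlock base.unlock lextU. Qed.

Lemma klin_demazure i : klin (demazure i).
Proof. by rewrite demazure.unlock; exact: lext_scal. Qed.

Lemma klin_tau i : klin (tau i).
Proof.
apply: klin_mul; last exact: klin_twist.
apply: klin_add; last exact: klin_B.
by apply: klin_mul; [exact: klin_B | exact: klin_hecke_l].
Qed.

Definition vB i : B := scalB (q i) + scalB (q' i) * transB (- c i).
Definition uB i : B := 1 - transB (- c i) ^+ 2.

Lemma vBE i x : val (vB i) x = q i *: x + q' i *: trans (- c i) x.
Proof. by []. Qed.

Lemma uBE i x : val (uB i) x = x - trans (- (c i *+ 2)) x.
Proof. by rewrite /uB transBX mulNrn. Qed.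

Lemma uB_demazure i : val (uB i) * demazure i = tau i + val (vB i).
Proof.
apply: klin_ext => [||y w].
- by apply: klin_mul; [exact: klin_B | exact: klin_demazure].
- by apply: klin_add; [exact: klin_tau | exact: klin_B].
rewrite endoM demazureE endofD.
have -> : val (uB i) (move_to w (bern i y)) =
    val (vB i) (base y w) - val (vB i) (base (weyl_act (s i) y) w).
  rewrite -endoM (val_B_comm _ (@centralizes_move_to R V I D K w)) endoM uBE bernE.
  rewrite -vBE -endoM -(val_B_comm _ (@centralizes_move_to R V I D K w)) endoM.
  by rewrite !endofB !move_toE.
rewrite endoD [tau i]/(gfac i _ * _) endoM twistE /gfac -/(uB i) -/(vB i).
rewrite (_ : (val (uB i) * hl i + val (- vB i)) (base (weyl_act (s i) y) w) =
  val (uB i) (hl i (base (weyl_act (s i) y) w)) - val (vB i) (base (weyl_act (s i) y) w)).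
  by rewrite addrA addrAC.
by rewrite rmorphN.
Qed.

Definition tauw w : endo H := weyl_lift tau w.

Lemma tauw_ascent i w : (len w < len (s i * w))%N -> tauw (s i * w)%g = tau i * tauw w.
Proof. by apply: weyl_lift_sl => j k; exact: tau_braid. Qed.

Lemma tau_tauw i w : exists b, tau i * tauw w = val b * tauw (s i * w)%g.
Proof.
have [iw|] := boolP (len w < len (s i * w))%N.
  by exists 1; rewrite rmorph1 mul1r tauw_ascent.
rewrite -ell_sl_lt => iw; exists (tau_sq D q q' i).
have E : tauw w = tau i * tauw (s i * w)%g.
  by have := @tauw_ascent i (s i * w)%g; rewrite weyl_sK => ->.
by rewrite E -tau_tau // mulrA.
Qed.

Definition tau_comb (l : seq (B * W)) : endo H := \sum_(p <- l) val p.1 * tauw p.2.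

(** Membership in the span of the tau_w over the fractions of R_1[Y], expressed with a regular left
    denominator instead of a localization. *)
Definition tau_fraction (x : endo H) := exists b l, regular b /\ val b * x = tau_comb l.

Lemma tau_comb_cat l1 l2 : tau_comb (l1 ++ l2) = tau_comb l1 + tau_comb l2.
Proof. exact: big_cat. Qed.

Lemma tau_combB b l : val b * tau_comb l = tau_comb [seq (b * p.1, p.2) | p <- l].
Proof.
rewrite /tau_comb big_map mulr_sumr; apply: eq_bigr => p _.
by rewrite rmorphM mulrA.
Qed.

Lemma tau_tau_comb i l : exists l', tau i * tau_comb l = tau_comb l'.
Proof.
elim: l => [|[b w] l [l' E]]; first by exists [::]; rewrite /tau_comb !big_nil mulr0.
have [b' E'] := tau_tauw i w.
exists ((conjB (s i) b * b', (s i * w)%g) :: l').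
rewrite /tau_comb !big_cons mulrDr -/(tau_comb l) -/(tau_comb l') E; congr (_ + _).
by rewrite mulrA tau_B // -mulrA E' mulrA -rmorphM.
Qed.

Lemma tau_fraction1 : tau_fraction 1.
Proof.
exists 1, [:: (1, 1%g)]; split; first exact: regular1.
by rewrite /tau_comb big_seq1 /= /tauw weyl_lift1 !mulr1.
Qed.

Lemma tau_fractionD x x' : tau_fraction x -> tau_fraction x' -> tau_fraction (x + x').
Proof.
move=> [b [l [br E]]] [b' [l' [br' E']]].
exists (b * b'), ([seq (b' * p.1, p.2) | p <- l] ++ [seq (b * p.1, p.2) | p <- l']).
split; first exact: regularM.
rewrite tau_comb_cat -!tau_combB -E -E' mulrDr !mulrA -!rmorphM.
by rewrite [b' * b]mulrC.
Qed.

Lemma tau_fractionB b x : tau_fraction x -> tau_fraction (val b * x).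
Proof.
move=> [b' [l [br E]]]; exists b', [seq (b * p.1, p.2) | p <- l]; split=> //.
by rewrite -tau_combB -E !mulrA -!rmorphM [b * _]mulrC.
Qed.

Lemma tau_fraction_demazure i x : tau_fraction x -> tau_fraction (demazure i * x).
Proof.
move=> [b [l [br E]]]; have [l' El'] := tau_tau_comb i l.
pose b' := conjB (s i) b.
(* Since u T_i = tau_i + v and b' tau_i = tau_i b, multiplying T_i x by b u b' gives b tau_i (b x) +
   b' v (b x). *)
exists (b * (uB i * b')), ([seq (b * p.1, p.2) | p <- l'] ++ [seq (b' * vB i * p.1, p.2) | p <- l]).
split.
  apply: regularM => //; apply: regularM; first exact: regular_coroot.
  exact: regular_conjB.
rewrite tau_comb_cat -!tau_combB -E -El' -E.
have -> : b * (uB i * b') = b * b' * uB i by rewrite -mulrA [uB i * _]mulrC.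
rewrite [val (_ * uB i)]rmorphM -mulrA (mulrA (val (uB i))) uB_demazure.
rewrite mulrDl mulrDr; congr (_ + _).
  by rewrite rmorphM -[LHS]mulrA (mulrA (val b')) -tau_B // -[(_ * val b) * x]mulrA.
by rewrite !mulrA -!rmorphM; congr (val _ * _); ring.
Qed.

Lemma proj_hl v i : proj v * hl i = proj (s i * v)%g +
  (if (len (s i * v) < len v)%N then scal _ (q i) * proj v else 0).
Proof.
have klin_if : klin (if (len (s i * v) < len v)%N then scal _ (q i) * proj v else 0).
  case: ifP => _; first by apply: klin_mul; [exact: klin_scal | exact: klin_proj].
  by move=> z; rewrite mulr0 mul0r.
apply: klin_ext => [||y w].
- by apply: klin_mul; [exact: klin_proj | exact: klin_hecke_l].
- by apply: klin_add => //; exact: klin_proj.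
have E1 : proj v (base y (s i * w)%g) = proj (s i * v)%g (base y w).
  apply: etrans (projE K v y (s i * w)%g) (etrans _ (esym (projE K (s i * v)%g y w))).
  by have -> : (s i * w == v)%g = (w == s i * v)%g by apply/eqP/eqP => [<-|->]; rewrite weyl_sK.
have E2 : proj v (if (len (s i * w) < len w)%N then q i *: base y w else 0) =
    (if (len (s i * v) < len v)%N then scal _ (q i) * proj v else 0) (base y w).
  have [->|wv] := eqVneq w v.
    by case: ifP => _; [exact: (klinZ _ _ (klin_proj v)) | exact: endof0].
  have pvw : proj v (base y w) = 0 by rewrite projE (negPf wv).
  transitivity (0 : H).
    case: ifP => _; last exact: endof0.
    by rewrite (klinZ _ _ (klin_proj v)) pvw scaler0.
  case: ifP => // _; rewrite -[RHS]/(scal _ (q i) (proj v (base y w))) pvw.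
  by rewrite endof0.
transitivity (proj v (hl i (base y w))); first by [].
by rewrite hecke_lE endofD E1 E2.
Qed.

Lemma proj_twist v u : proj v * twist u = twist u * proj v.
Proof.
apply: klin_ext => [||y w]; try by apply: klin_mul; first [exact: klin_proj | exact: klin_twist].
by rewrite !endoM twistE !projE; case: ifP => _; rewrite ?twistE ?endof0.
Qed.

Lemma twist_base0 u w : twist u (base 0 w) = base 0 w.
Proof. by rewrite twistE raddf0. Qed.

Lemma proj_B v b : proj v * val b = val b * proj v.
Proof. by rewrite val_B_comm //; exact: centralizes_proj. Qed.

(** Each tau_i lengthens words by at most one letter and contributes a factor 1 - Z^(-2 c_i) to the
    leading term. The coefficient of H_w is thus a product of twisted regular elements. *)
Lemma tauw_triangular w : exists2 b, regular b & forall v, (len w <= len v)%N ->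
  proj v (tauw w (base 0 1%g)) = if v == w then val b (base 0 1%g) else 0.
Proof.
have [n] := ubnP (len w); elim: n w => // n IHn w wn.
have [->|/weyl_left_descent[i iw]] := pselect (w = 1%g).
  exists 1; first exact: regular1.
  by move=> v _; rewrite rmorph1 /tauw weyl_lift1 endo1 projE eq_sym.
have {}wn : (len (s i * w) < n)%N by rewrite -ltnS (leq_trans _ wn).
pose w' := (s i * w)%g; have [b br bE] := IHn w' wn.
have wE : w = (s i * w')%g by rewrite weyl_sK.
exists (uB i * conjB (s i) b).
  by apply: regularM; [exact: regular_coroot | exact: regular_conjB].
move=> v wv; rewrite {1}wE tauw_ascent ?weyl_sK // endoM.
set x := tauw w' _.
have pv0 : proj v x = 0.
  rewrite bE; last by apply: leq_trans wv; exact: ltnW.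
  by case: eqP => // vw'; move: iw; rewrite -/w' -vw' ltnNge wv.
(* As v is longer than w', the vector x has no component at H_v. The component of tau_i x there can
   only come from H_(r_i v). *)
have pv : proj v (tau i x) = val (uB i) (twist (s i) (proj (s i * v)%g x)).
  have -> : proj v (tau i x) = val (uB i) ((proj v * hl i) (twist (s i) x)) -
      val (vB i) (proj v (twist (s i) x)).
    transitivity (proj v (val (uB i) (hl i (twist (s i) x)) + val (- vB i) (twist (s i) x))).
      by [].
    rewrite endofD; congr (_ + _).
      exact: (congr1 (fun f : endo H => f (hl i (twist (s i) x))) (proj_B v (uB i))).
    transitivity ((proj v * val (- vB i)) (twist (s i) x)); first by [].
    by rewrite proj_B rmorphN.
  have pt u : proj u (twist (s i) x) = twist (s i) (proj u x).
    exact: (congr1 (fun f : endo H => f x) (proj_twist u (s i))).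
  rewrite proj_hl -(pt (s i * v)%g) pt pv0 !endof0 subr0; congr (val (uB i) _).
  rewrite -[RHS]addr0 -[LHS]/(_ (twist (s i) x) + _ (twist (s i) x)); congr (_ + _).
  case: ifP => _ //; rewrite -[LHS]/(scal _ (q i) (proj v (twist (s i) x))) pt pv0.
  by rewrite !endof0.
rewrite pv bE; last first.
  rewrite -ltnS; apply: leq_trans (ell_sl_ge i v).
  by apply: leq_trans wv.
have -> : (s i * v == w')%g = (v == w) by rewrite (can_eq (weyl_sK i)).
case: eqP => _; last by rewrite !endof0.
transitivity (val (uB i) ((twist (s i) * val b) (base 0 1%g))); first by [].
rewrite twist_B rmorphM.
transitivity (val (uB i) (val (conjB (s i) b) (twist (s i) (base 0 1%g)))); first by [].
by rewrite twist_base0.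
Qed.

(** Every Z^y H_w is the image of H_1 under translations and [move_to], and these commute with
    [b]. *)
Lemma B_eq0 b : val b (base 0 1%g) = 0 -> b = 0.
Proof.
move=> b0; apply: val_inj; rewrite rmorph0; apply: klin_ext => [||y w].
- exact: klin_B.
- by move=> z; rewrite mulr0 mul0r.
have -> : base y w = move_to w (trans y (base 0 1%g)) by rewrite transE move_toE add0r.
transitivity ((val b * move_to w * trans y) (base 0 1%g)); first by [].
rewrite (val_B_comm _ (@centralizes_move_to R V I D K w)) -mulrA trans_B_comm.
transitivity (move_to w (trans y (val b (base 0 1%g)))); first by [].
by rewrite b0 !endof0.
Qed.

(** Induction on [M - len w], from the longest elements downwards: the longer terms are already
    zero, and projecting to H_w isolates f w times a regular element. *)
Lemma tau_indep (f : W -> B) (r : seq W) : uniq r ->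
  (\sum_(w <- r) val (f w) * tauw w) (base 0 1%g) = 0 -> forall w, w \in r -> f w = 0.
Proof.
move=> ru f0 w; pose M := \max_(v <- r) len v.
have [n] := ubnP (M - len w); elim: n w => // n IHn w wn wr.
have above v : v \in r -> (len w < len v)%N -> f v = 0.
  move=> vr wv; apply: IHn => //; rewrite -ltnS (leq_trans _ wn) // ltnS ltn_sub2l //.
  by apply: leq_trans wv _; rewrite /M; exact: leq_bigmax_seq.
have [b br bE] := tauw_triangular w.
have E : val (f w) (val b (base 0 1%g)) = 0.
  rewrite -(endof0 (proj w)) -f0 endo_sum raddf_sum (bigD1_seq w) //= [X in _ + X]big1_seq ?addr0.
    transitivity ((proj w * val (f w)) (tauw w (base 0 1%g))); last by [].
    by rewrite proj_B -[RHS]/(val (f w) (proj w (tauw w (base 0 1%g)))) bE ?eqxx.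
  move=> v /andP[vw vr].
  transitivity ((proj w * val (f v)) (tauw v (base 0 1%g))); first by [].
  rewrite proj_B; have [wv|vlw] := ltnP (len w) (len v); first by rewrite above // rmorph0 mul0r.
  have [b' _ bE'] := tauw_triangular v.
  rewrite -[LHS]/(val (f v) (proj w (tauw v (base 0 1%g)))) bE' //.
  by rewrite eq_sym (negPf vw) endof0.
have : b * f w = 0 by apply: B_eq0; rewrite mulrC rmorphM.
move=> /(congr1 val); rewrite rmorphM rmorph0 => E'.
apply: val_inj; rewrite rmorph0; apply: endoP => x; apply: br.
by rewrite -endoM E'.
Qed.

Lemma tau_comb_eq0 l : tau_comb l (base 0 1%g) = 0 -> tau_comb l = 0.
Proof.
pose f w : B := \sum_(p <- l | p.2 == w) p.1; pose r := undup (map snd l).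
have E : tau_comb l = \sum_(w <- r) val (f w) * tauw w.
  rewrite /f; under [RHS]eq_bigr do rewrite rmorph_sum mulr_suml.
  under [RHS]eq_bigr do rewrite big_mkcond.
  rewrite exchange_big /= /tau_comb; apply: eq_big_seq => p pl.
  rewrite -big_mkcond (big_rem p.2) /=; last by rewrite mem_undup map_f.
  rewrite eqxx big1_seq ?addr0 // => w /andP[/eqP <-].
  by rewrite mem_rem_uniq ?undup_uniq // inE eqxx.
rewrite E => /(tau_indep (undup_uniq _)) f0.
by rewrite big1_seq // => w /andP[_ wr]; rewrite f0 // rmorph0 mul0r.
Qed.

Lemma tau_fraction_eq0 x : tau_fraction x -> x (base 0 1%g) = 0 -> x = 0.
Proof.
move=> [b [l [br E]]] x0.
have l0 : tau_comb l = 0 by apply: tau_comb_eq0; rewrite -E endoM x0 endof0.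
by apply: endoP => z; apply: br; rewrite -endoM E l0.
Qed.

End DemazureLusztig.

(** * The product *)

Section Algebra.
Variables (R : realType) (V : vectType R) (I : finType) (D : root_datum V I).
Variables (K : comNzRingType) (q q' : I -> K).
Hypothesis q_conj : forall i j, i != j -> bond D i j = 3%N -> q i = q j.
Hypothesis q_odd : forall i (y : lattice_type D), odd `|pairing i y|%N -> q' i = q i.

Local Notation W := (weyl_type D).
Local Notation Y := (lattice_type D).
Local Notation s := (weyl_s D).
Local Notation H := {freeg (Y * W) / K}.
Local Notation len w := (@ell R V I D w%g).
Local Notation B := (bicommutant (@scalar_op R V I D K)).
Local Notation hl := (hecke_l D q).
Local Notation c := (coroot D).
Local Notation base := (@base R V I D K).
Local Notation klin := (@klin R V I D K).
Local Notation trans := (@trans R V I D K).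
Local Notation move_to := (@move_to R V I D K).
Local Notation transB := (@transB R V I D K).
Local Notation scalB := (@scalB R V I D K).
Implicit Types (i j k : I) (u v w : W) (y mu : Y) (b : B).

Variable bern : I -> Y -> H.
Hypothesis bern_supp : forall i y, move_to 1%g (bern i y) = bern i y.
Hypothesis bernE : forall i y, let x := base y 1%g - base (weyl_act (s i) y) 1%g in
  bern i y - trans (- (c i *+ 2)) (bern i y) = q i *: x + q' i *: trans (- c i) x.

Local Notation demazure := (@demazure R V I D K q bern).

Local Notation Tw w := (\prod_(k <- reduced_word w) demazure k).

Lemma bern0 i : bern i 0 = 0.
Proof.
apply: (@regular_coroot R V I D K i); rewrite -/(uB D K i) uBE bernE.
by rewrite raddf0 subrr endof0 !scaler0 addr0.
Qed.

Lemma demazure_base0 i w : demazure i (base 0 w) = hl i (base 0 w).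
Proof. by rewrite demazureE raddf0 bern0 endof0 addr0. Qed.

Lemma demazure_word l : size l = len (weyl_prod D l) ->
  (\prod_(k <- l) demazure k) (base 0 1%g) = base 0 (weyl_prod D l).
Proof.
elim: l => [|i l IHl] /= ll; first by rewrite big_nil.
have E : size l = len (weyl_prod D l).
  by apply/eqP; rewrite eqn_leq ell_prod andbT -ltnS ll ell_sl.
by rewrite big_cons endoM IHl // demazure_base0 hecke_l_ascent // -E -ll.
Qed.

Lemma reduced_word1 : reduced_word (1%g : W) = [::].
Proof. by apply: size0nil; rewrite size_reduced_word ell1. Qed.

Lemma ell_s i : len (s i) = 1%N.
Proof.
have := @ell_sl _ _ _ D i 1%g; have := @ell_sl_neq _ _ _ D i 1%g.
by rewrite mulg1 ell1; case: (len (s i)) => [|[]].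
Qed.

Lemma reduced_word_s i : reduced_word (s i) = [:: i].
Proof.
have := size_reduced_word (s i); have := prod_reduced_word (s i); rewrite ell_s.
case: (reduced_word (s i)) => [|j []] //= + _.
by rewrite mulg1 => /weyl_s_inj ->.
Qed.

Definition basis_op (p : Y * W) : endo H := trans p.1 * Tw p.2.

Lemma klin_basis_op p : klin (basis_op p).
Proof.
apply: klin_mul; first exact: klin_trans.
by apply: klin_prod => k; exact: klin_demazure.
Qed.

Lemma basis_op_base0 y w : basis_op (y, w) (base 0 1%g) = base y w.
Proof.
rewrite endoM /= demazure_word ?prod_reduced_word ?size_reduced_word //.
by rewrite transE add0r.
Qed.

Definition hecke_mul (x z : H) : H := lext (fun p => basis_op p z) x.

(** The product with fixed left factor, written as a finite sum in the ring generated by the T_i and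
    R_1[Y], so that [tau_fraction] applies to it. *)
Definition mul_op (x : H) : endo H := \sum_(p <- dom x) scal _ (coeff p x) * basis_op p.

Lemma hecke_mulE x z : hecke_mul x z = mul_op x z.
Proof.
rewrite /hecke_mul -{1}[x]freeg_sumE raddf_sum endo_sum; apply: eq_bigr => p _ /=.
by rewrite liftU.
Qed.

Lemma klin_mul_op x : klin (mul_op x).
Proof.
rewrite /mul_op; elim/big_ind: _ => [z|f g|p _].
- by rewrite mulr0 mul0r.
- exact: klin_add.
- by apply: klin_mul; [exact: klin_scal | exact: klin_basis_op].
Qed.

Lemma hecke_mul_base y w z : hecke_mul (base y w) z = trans y (Tw w z).
Proof. by rewrite /hecke_mul base.unlock lextU. Qed.

Lemma hecke_mul_linearl z : linear (hecke_mul^~ z).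
Proof. by move=> a x x'; rewrite /hecke_mul endofD lextZ. Qed.

Lemma hecke_mul_linearr x : linear (hecke_mul x).
Proof.
by move=> a z z'; rewrite !hecke_mulE endofD (klinZ _ _ (klin_mul_op x)).
Qed.

Lemma tau_fraction_mul_op x f : tau_fraction q q' f -> tau_fraction q q' (mul_op x * f).
Proof.
move=> fQ; rewrite /mul_op mulr_suml; elim/big_ind: _ => [|g g'|p _].
- by rewrite -(mul0r f) -(rmorph0 (val : {rmorphism B -> endo H})); exact: tau_fractionB.
- exact: tau_fractionD.
rewrite -mulrA -[scal _ _]/(val (scalB _)); apply: tau_fractionB.
rewrite /basis_op -mulrA -[trans _]/(val (transB _)); apply: tau_fractionB.
elim: (reduced_word _) => [|i l IHl]; first by rewrite big_nil mul1r.
by rewrite big_cons -mulrA; apply: tau_fraction_demazure.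
Qed.

Lemma hecke_mul1r x : hecke_mul x (base 0 1%g) = x.
Proof.
rewrite -[RHS]freeg_sumE hecke_mulE endo_sum; apply: eq_bigr => -[y w] _.
rewrite freegZU -[LHS]/(coeff _ x *: (basis_op (y, w) (base 0 1%g))) basis_op_base0.
by rewrite base.unlock.
Qed.

Lemma hecke_mul1l x : hecke_mul (base 0 1%g) x = x.
Proof. by rewrite hecke_mul_base trans0 reduced_word1 big_nil. Qed.

Lemma mul_op_mul x z : mul_op x * mul_op z = mul_op (hecke_mul x z).
Proof.
apply/eqP; rewrite -subr_eq0; apply/eqP; apply: (@tau_fraction_eq0 R V I D K q q') => //.
  apply: tau_fractionD => //; first rewrite -[mul_op z]mulr1.
    by do 2!apply: tau_fraction_mul_op; exact: tau_fraction1.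
  rewrite -mulN1r -(rmorph1 (val : {rmorphism B -> endo H})) -rmorphN; apply: tau_fractionB.
  by rewrite -[mul_op _]mulr1; apply: tau_fraction_mul_op; exact: tau_fraction1.
rewrite -[LHS]/(mul_op x (mul_op z _) - mul_op (hecke_mul x z) (base 0 1%g)).
by rewrite -!hecke_mulE !hecke_mul1r subrr.
Qed.

Lemma hecke_mulA : associative hecke_mul.
Proof.
by move=> x z t; rewrite [RHS]hecke_mulE -mul_op_mul endoM -!hecke_mulE.
Qed.

Definition bernstein_algebra (m : H -> H -> H) : Prop :=
  [/\ forall x, linear (m x), forall z, linear (m^~ z),
      associative m, left_id (base 0 1%g) m & right_id (base 0 1%g) m] /\
  [/\ forall y w, m (base y 1%g) (base 0 w) = base y w,
      forall i w, m (base 0 (s i)) (base 0 w) = hl i (base 0 w),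
      forall y z, m (base y 1%g) (base z 1%g) = base (y + z) 1%g
    & forall y i, m (base 0 (s i)) (base y 1%g) -
        m (base (weyl_act (s i) y) 1%g) (base 0 (s i)) = bern i y].

Lemma hecke_mul_s i z : hecke_mul (base 0 (s i)) z = demazure i z.
Proof. by rewrite hecke_mul_base reduced_word_s big_seq1 trans0. Qed.

Lemma hecke_mul_trans y z : hecke_mul (base y 1%g) z = trans y z.
Proof. by rewrite hecke_mul_base reduced_word1 big_nil. Qed.

Lemma hecke_mul_bernstein : bernstein_algebra hecke_mul.
Proof.
split; split.
- exact: hecke_mul_linearr.
- exact: hecke_mul_linearl.
- exact: hecke_mulA.
- exact: hecke_mul1l.
- exact: hecke_mul1r.
- by move=> y w; rewrite hecke_mul_trans transE add0r.
- by move=> i w; rewrite hecke_mul_s demazure_base0.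
- by move=> y z; rewrite hecke_mul_trans transE addrC.
move=> y i; rewrite hecke_mul_s hecke_mul_trans demazureE transE add0r bern_supp.
rewrite hecke_l_ascent ?mulg1; first by rewrite addrC addKr.
by rewrite ell1 ell_s.
Qed.

Lemma linear_ext (f g : H -> H) : linear f -> linear g ->
  (forall y w, f (base y w) = g (base y w)) -> f =1 g.
Proof.
move=> fL gL fg.
pose F : {linear H -> H} := HB.pack f (GRing.isLinear.Build _ _ _ _ f fL).
pose G : {linear H -> H} := HB.pack g (GRing.isLinear.Build _ _ _ _ g gL).
apply: freeg_ext => [x z|x z|z [y w]].
- exact: (raddfB F).
- exact: (raddfB G).
rewrite -[LHS]/(F _) -[RHS]/(G _) !linearZ_LR /=; congr (_ *: _).
by have := fg y w; rewrite base.unlock.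
Qed.

Lemma endo_linear (f : endo H) : klin f -> linear f.
Proof. by move=> fk a x z; rewrite endofD (klinZ _ _ fk). Qed.

(** Associativity with (1) and (3) makes multiplication by Z^y a translation; with (2) and (4) it
    then makes multiplication by H_i equal to T_i. A reduced word gives multiplication by H_w, and
    (1) gives that by Z^y H_w. *)
Lemma bernstein_algebra_uniq m : bernstein_algebra m -> m =2 hecke_mul.
Proof.
move=> [[mr ml mA m1l m1r] [mZH mHH mZZ mHZ]].
have mZ y z : m (base y 1%g) z = trans y z.
  move: z; apply: linear_ext => //; first exact/endo_linear/klin_trans.
  by move=> y' w; rewrite -[base y' w]mZH mA mZZ !mZH transE addrC.
(* [move_to] at 1 puts the left factor in R_1[Y], where (1) determines its product with H_w;
   [bern_supp] gives b_i(y) this form. *)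
have mbern x w : m (move_to 1%g x) (base 0 w) = move_to w x.
  move: x; apply: linear_ext => [a x z||y v].
  - by rewrite endofD (klinZ _ _ (klin_move_to _)) ml.
  - exact/endo_linear/klin_move_to.
  - by rewrite !move_toE mZH.
have ms i z : m (base 0 (s i)) z = demazure i z.
  move: z; apply: linear_ext => //; first exact/endo_linear/klin_demazure.
  move=> y w; rewrite -{1}[base y w]mZH mA.
  have -> : m (base 0 (s i)) (base y 1%g) =
     m (base (weyl_act (s i) y) 1%g) (base 0 (s i)) + bern i y by rewrite -mHZ addrC subrK.
  have mD x x' z : m (x + x') z = m x z + m x' z.
    by have := ml z 1 x x'; rewrite !scale1r.
  rewrite mD -mA mHH -(bern_supp i y) mbern mZ demazureE; congr (_ + _).
  have -> : base (weyl_act (s i) y) w = trans (weyl_act (s i) y) (base 0 w).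
    by rewrite transE add0r.
  by rewrite -[RHS]endoM (@centralizes_hecke_l R V I D K q i) //; left; eexists.
have mw l z : size l = len (weyl_prod D l) ->
    m (base 0 (weyl_prod D l)) z = (\prod_(k <- l) demazure k) z.
  elim: l => [|i l IHl] /= ll; first by rewrite big_nil m1l.
  have E : size l = len (weyl_prod D l).
    by apply/eqP; rewrite eqn_leq ell_prod andbT -ltnS ll ell_sl.
  rewrite big_cons endoM -IHl // -ms mA mHH hecke_l_ascent // -E -ll.
  exact: leqnn.
move=> x z; move: x; apply: linear_ext => //; first exact: hecke_mul_linearl.
move=> y w; rewrite hecke_mul_base -mw ?prod_reduced_word ?size_reduced_word //.
by rewrite -mZ mA mZH.
Qed.

End Algebra.

(** * Specialization to the parameters of R_1 *)

Section BernsteinLusztig.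
Variables (R : realType) (V : vectType R) (I : finType) (D : root_datum V I).

Local Notation K := (R1 D : comNzRingType).
Local Notation base := (@base R V I D K).
Local Notation q := (fun i => sigma D i - (sigma D i)^-1 : K).
Local Notation q' := (fun i => sigma' D i - (sigma' D i)^-1 : K).
Local Notation bern := (fun i y => bernstein i y : {freeg (lattice_type D * weyl_type D) / K}).

Lemma ZHE y w : ZH y w = base y w.
Proof. by rewrite base.unlock. Qed.

Lemma sigma_conj i j : i != j -> bond D i j = 3%N -> q i = q j.
Proof.
move=> ij b3.
have spec3 (x y : R) m : bond_spec x y m -> m = 3%N -> x = 1 /\ y = 1 by case.
have [/eqP + /eqP] := spec3 _ _ _ (bondP D ij) b3.
rewrite /cartan !eqr_oppLR => /eqP cij /eqP cji.
by have [-> _ _] := sigma_adjacent cij cji.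
Qed.

Lemma sigma_odd i (y : lattice_type D) : odd `|pairing i y|%N -> q' i = q i.
Proof. by move=> /pairing_odd ->. Qed.

Lemma shiftE mu x : shift mu x = trans K mu x.
Proof. by rewrite trans.unlock base.unlock. Qed.

Lemma bernstein_supp i y : move_to K 1%g (bern i y) = bern i y.
Proof.
have E (t : R1 D) z : move_to K 1%g (t *: ZL z) = t *: ZL z.
  by rewrite (klinZ _ _ (klin_move_to _)) /ZL ZHE move_toE.
have S (J : Type) (r : seq J) (P : pred J) (t : R1 D) (F : J -> lattice_type D) :
   move_to K 1%g (\sum_(k <- r | P k) t *: ZL (F k)) = \sum_(k <- r | P k) t *: ZL (F k).
  by elim/big_rec: _ => [|k x _ IH]; rewrite ?endof0 // endofD E IH.
by rewrite /bernstein; case: ifP => _; rewrite endofD !(endofN, S).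
Qed.

Lemma bernstein_fraction i y :
  let x := base y 1%g - base (weyl_act (weyl_s D i) y) 1%g in
  bern i y - trans K (- (coroot D i *+ 2)) (bern i y) =
  q i *: x + q' i *: trans K (- coroot D i) x.
Proof.
by move=> x; have := bernsteinE i y; rewrite /= /ZL !ZHE !shiftE.
Qed.

Lemma hecke_l_HW i w : hecke_l D q i (HW w) = HW (weyl_mul (weyl_s D i) w) +
  (if (weyl_length (weyl_mul (weyl_s D i) w) < weyl_length w)%N then q i *: HW w else 0).
Proof. by rewrite /HW !ZHE hecke_lE !ellE. Qed.

End BernsteinLusztig.

Theorem theorem6p2 (R : realType) (V : vectType R) (I : finType)
    (D : root_datum V I) :
  exists! mul : hecke D -> hecke D -> hecke D,
    unital_algebra mul (HW (weyl1 D)) /\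
    [/\ forall (y : lattice_type D) (w : weyl_type D),
          mul (ZL y) (HW w) = ZH y w,
        forall (i : I) (w : weyl_type D),
          ((weyl_length w < weyl_length (weyl_mul (weyl_s D i) w))%N ->
             mul (HS D i) (HW w) = HW (weyl_mul (weyl_s D i) w)) /\
          ((weyl_length (weyl_mul (weyl_s D i) w) < weyl_length w)%N ->
             mul (HS D i) (HW w) =
             (sigma D i - (sigma D i)^-1) *: HW w +
               HW (weyl_mul (weyl_s D i) w)),
        forall y z : lattice_type D, mul (ZL y) (ZL z) = ZL (y + z)
      & forall (y : lattice_type D) (i : I),
          mul (HS D i) (ZL y) - mul (ZL (weyl_act (weyl_s D i) y)) (HS D i) =
          bernstein i y].
Proof.
pose q i : R1 D := sigma D i - (sigma D i)^-1.
pose q' i : R1 D := sigma' D i - (sigma' D i)^-1.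
pose bern i y : hecke D := bernstein i y.
have equiv (m : hecke D -> hecke D -> hecke D) : bernstein_algebra q bern m <->
    unital_algebra m (HW (weyl1 D)) /\
    [/\ forall (y : lattice_type D) (w : weyl_type D), m (ZL y) (HW w) = ZH y w,
        forall (i : I) (w : weyl_type D),
          ((weyl_length w < weyl_length (weyl_mul (weyl_s D i) w))%N ->
             m (HS D i) (HW w) = HW (weyl_mul (weyl_s D i) w)) /\
          ((weyl_length (weyl_mul (weyl_s D i) w) < weyl_length w)%N ->
             m (HS D i) (HW w) =
             (sigma D i - (sigma D i)^-1) *: HW w + HW (weyl_mul (weyl_s D i) w)),
        forall y z : lattice_type D, m (ZL y) (ZL z) = ZL (y + z)
      & forall (y : lattice_type D) (i : I),
          m (HS D i) (ZL y) - m (ZL (weyl_act (weyl_s D i) y)) (HS D i) = bernstein i y].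
  (* The two implications of (2) amount to one formula because the lengths of w and r_i w always
     differ; exactly one of the two premises holds. *)
  have HH (x : hecke D) i w : x = hecke_l D q i (HW w) <->
      ((weyl_length w < weyl_length (weyl_mul (weyl_s D i) w))%N ->
         x = HW (weyl_mul (weyl_s D i) w)) /\
      ((weyl_length (weyl_mul (weyl_s D i) w) < weyl_length w)%N ->
         x = (sigma D i - (sigma D i)^-1) *: HW w + HW (weyl_mul (weyl_s D i) w)).
    rewrite hecke_l_HW !ellE; have : ell (weyl_mul (weyl_s D i) w) <> ell w by exact: ell_sl_neq.
    case: ltngtP => [lt|lt|-> //] _; rewrite ?addr0; split=> [->|[E1 E2]].
    - by split=> // _; rewrite addrC.
    - by rewrite E2 // addrC.
    - by split.
    - exact: E1.
  rewrite /bernstein_algebra base.unlock.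
  split=> [[alg [h1 h2 h3 h4]]|[alg [h1 h2 h3 h4]]]; split=> //; split=> //.
    by move=> i w; apply/HH; exact: h2.
  by move=> i w; apply/HH; exact: h2.
have bs := @bernstein_supp R V I D.
have bE := @bernstein_fraction R V I D.
exists (hecke_mul q bern); split.
  apply/equiv; apply: (@hecke_mul_bernstein R V I D _ q q') => //.
  - exact: sigma_conj.
  - exact: sigma_odd.
move=> m /equiv/bernstein_algebra_uniq mE.
by apply/funext => x; apply/funext => z; rewrite mE.
Qed.
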